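(* Let $\mathcal{E}_{\mathrm{AM}}$ be the Dirichlet form of the adjacent move chain $P_{\mathrm{AM}}$ with respect to the uniform distribution over $2$-Dyck paths of length $3n$, and let $\mathcal{E}_{\mathrm{FM}}$ be the Dirichlet form of the flip chain $P_{\mathrm{FM}}$ with respect to the uniform distribution over non-crossing spanning trees with $n$ edges. Identify the two state spaces through the bijection $X\mapsto T_X$ from $2$-Dyck paths of length $3n$ to non-crossing spanning trees with $n$ edges, so that a function $f$ on paths is also viewed as a function on trees via $f(T_X)=f(X)$. Then for all real-valued functions $f$ on this common state space, $$\mathcal{E}_{\mathrm{FM}}(f,f)\ \ge\ \Omega(n^{-4})\cdot\mathcal{E}_{\mathrm{AM}}(f,f),$$ where the constant implied by $\Omega(\cdot)$ is absolute (independent of $n$ and $f$).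
   Context: A $2$-Dyck path of length $3n$ is a sequence $a_1,\dots,a_{3n}\in\{+1,-2\}$ with all partial sums $\ge 0$ and total sum $0$; write $\nearrow$ for $+1$ and $\searrow$ for $-2$. Non-crossing spanning trees (NCSTs) with $n$ edges: spanning trees on the points $0,1,\dots,n$ (arranged in convex position in this cyclic order or, equivalently, on a line with edges drawn as arcs above the line), with edges written as pairs $(a,b)$, $a<b$, such that there are no two edges $(a,b)$, $(c,d)$ with $a<c<b<d$. For $s\le t$, $[s,t]$ denotes the subtree spanned by the points $s,s+1,\dots,t$; it is empty (has no edges) if $s=t$. Decomposition of trees: a non-empty NCST $T$ on $0,\dots,n$ decomposes uniquely into $(T_A,T_B,T_C)$ as follows. Let $t$ be the maximum index such that $(0,t)$ is an edge; let $s$ be the index such that, after removing the edge $(0,t)$, the subtree $[0,s]$ is connected but $[0,s+1]$ is not. Then $T_A=[0,s]$, $T_B=[s+1,t]$, $T_C=[t,n]$ (each regarded as an NCST after relabelling its points by a shift). Bijection $X\mapsto T_X$: the empty path corresponds to the empty tree (a single point), and, inductively, if $T$ decomposes into $(T_A,T_B,T_C)$ and these correspond to paths $A,B,C$, then $T$ corresponds to the path $\nearrow A\nearrow B\searrow C$. Adjacent move chain $P_{\mathrm{AM}}$ on $2$-Dyck paths of length $3n$: from the current path $X$, choose $i\in\{1,\dots,3n-1\}$ uniformly at random and let $X'$ be $X$ with the steps at positions $i$ and $i+1$ swapped. If $X'$ is not a $2$-Dyck path, stay at $X$; otherwise move to $X'$ with probability $1/2$ and stay at $X$ with probability $1/2$.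 Thus $P_{\mathrm{AM}}(X,X')=\frac{1}{6n-2}$ whenever $X'\neq X$ is a $2$-Dyck path obtained from $X$ by swapping two adjacent steps, and $P_{\mathrm{AM}}(X,X')=0$ for other $X'\ne X$. Flip chain $P_{\mathrm{FM}}$ on NCSTs with $n$ edges: from the current tree $S$, remove an edge of $S$ chosen uniformly at random, then add an edge chosen uniformly at random among all edges (including the removed one) whose addition gives an NCST. For $S\neq T$, $P_{\mathrm{FM}}(S,T)=\frac{1}{n\,\delta(S,T)}$ if $|S\cap T|=n-1$ (trees viewed as edge sets), where $\delta(S,T)$ is the number of edges that can be added to $S\cap T$ to make it an NCST, and $P_{\mathrm{FM}}(S,T)=0$ if $|S\cap T|<n-1$. Dirichlet form of a chain $P$ with stationary distribution $\pi$ on a finite set $\Omega$: $\mathcal{E}_P(f,g)=\frac12\sum_{x,y\in\Omega}[f(x)-f(y)][g(x)-g(y)]\pi(x)P(x,y)$. Both chains have the uniform distribution as stationary distribution. *)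

(* Defs.v *)
From HB Require Import structures.
From mathcomp Require Import all_boot all_order all_algebra.
From mathcomp Require Import reals.

Set Implicit Arguments.
Unset Strict Implicit.
Unset Printing Implicit Defensive.

Import Order.TTheory GRing.Theory Num.Theory.
Local Open Scope ring_scope.

Section MarkovChains.
Variables (R : realType) (Omega : finType).

Definition uniform (x : Omega) : R := #|Omega|%:R^-1.

Definition dirichlet (pi : Omega -> R) (P : Omega -> Omega -> R)
    (f g : Omega -> R) : R :=
  2^-1 * \sum_(x : Omega) \sum_(y : Omega)
           (f x - f y) * (g x - g y) * pi x * P x y.

End MarkovChains.

(* A path is the list of its steps; [true] is the up step +1 and [false] the *)
(* down step -2.                                                             *)
Definition step (b : bool) : int := if b then 1 else (-2)%Z.

Definition is_dyck2 (s : seq bool) : bool :=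
  [forall k : 'I_(size s).+1, 0 <= \sum_(b <- take k s) step b]
  && (\sum_(b <- s) step b == 0).

Definition dyck2 (n : nat) := {s : (3 * n).-tuple bool | is_dyck2 s}.
HB.instance Definition _ n := Finite.on (dyck2 n).

Definition steps (n : nat) (X : dyck2 n) : seq bool := tval (val X).

(* Exchange the (0-based) positions i and i+1.                               *)
Definition swap_adj (i : nat) (s : seq bool) : seq bool :=
  set_nth false (set_nth false s i (nth false s i.+1)) i.+1 (nth false s i).

Definition P_AM (R : realType) (n : nat) (X Y : dyck2 n) : R :=
  \sum_(i < 3 * n - 1)
    (3 * n - 1)%:R^-1 *
    (if is_dyck2 (swap_adj i (steps X))
     then 2^-1 * (steps Y == swap_adj i (steps X))%:R + 2^-1 * (Y == X)%:R
     else (Y == X)%:R).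

(* Graphs on the points 0, ..., n; an edge is a pair (a, b) with a < b.      *)
Definition edge (n : nat) := ('I_n.+1 * 'I_n.+1)%type.

Section Graphs.
Variables (n : nat) (T : {set edge n}).

Definition adj : rel 'I_n.+1 :=
  fun x y => ((x, y) \in T) || ((y, x) \in T).

Definition is_connected : bool :=
  [forall x, forall y, connect adj x y].

(* A closed walk x, y, x along one edge is a ucycle of length 2, whence the  *)
(* bound.                                                                    *)
Definition is_acyclic : bool :=
  [forall k : 'I_n.+2, forall p : k.-tuple 'I_n.+1,
     ucycleb adj p ==> (k <= 2)%N].

Definition is_noncrossing : bool :=
  [forall e in T, forall e' in T,
     ~~ [&& (e.1 < e'.1)%N, (e'.1 < e.2)%N & (e.2 < e'.2)%N]].

Definition is_ncst : bool :=
  [&& [forall e in T, (e.1 < e.2)%N], is_connected, is_acyclic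
    & is_noncrossing].

(* The graph [a, a + k] induced on the points a, ..., a + k (for a + k <= n), *)
(* relabelled by the shift x |-> x - a.                                      *)
Definition segment (a k : nat) : {set edge k} :=
  [set e : edge k | (inord (a + e.1), inord (a + e.2)) \in T].

End Graphs.

Definition ncst (n : nat) := {T : {set edge n} | is_ncst T}.
HB.instance Definition _ n := Finite.on (ncst n).

Definition edges (n : nat) (T : ncst n) : {set edge n} := val T.

Definition addable (n : nat) (U : {set edge n}) : {set edge n} :=
  [set e | is_ncst (e |: U)].

Definition P_FM (R : realType) (n : nat) (S T : ncst n) : R :=
  \sum_(e in edges S) n%:R^-1 *
    \sum_(e' in addable (edges S :\ e))
      #|addable (edges S :\ e)|%:R^-1 *
      (edges T == e' |: (edges S :\ e))%:R.

(* Before reaching s, the induced graphs [0, k] may be disconnected and then *)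
(* connected again (take the edges (0, 3), (0, 2), (1, 2) and k = 0, 1, 2):  *)
(* s is the last index for which [0, s] is connected.                        *)
Definition decomposes (n : nat) (T : {set edge n}) (s t : 'I_n.+1) : Prop :=
  [/\ (ord0, t) \in T,
      forall u : 'I_n.+1, (ord0, u) \in T -> (u <= t)%N,
      is_connected (segment (T :\ (ord0, t)) 0 s)
    & forall k : nat, (s < k <= n)%N ->
        ~~ is_connected (segment (T :\ (ord0, t)) 0 k)].

(* The graph of the bijection X |-> T_X: [tree_path T X] holds iff T = T_X.  *)
Inductive tree_path (n : nat) (T : {set edge n}) : seq bool -> Prop :=
| TreePathEmpty :
    n = 0%N -> T = set0 -> tree_path T [::]
| TreePathNode (s t : 'I_n.+1) (A B C : seq bool) :
    decomposes T s t ->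
    tree_path (segment T 0 s) A ->
    tree_path (segment T s.+1 (t - s.+1)) B ->
    tree_path (segment T t (n - t)) C ->
    tree_path T (true :: A ++ true :: B ++ false :: C).

(* Main.v *)
Require Import Defs.
From HB Require Import structures.
From mathcomp Require Import all_boot all_order all_algebra.
From mathcomp Require Import reals.
From mathcomp Require Import boolp zify ring lra.

Set Implicit Arguments.
Unset Strict Implicit.
Unset Printing Implicit Defensive.

Import Order.TTheory GRing.Theory Num.Theory.

(** Both state spaces are copies of the ternary trees with [n] nodes: the tree
    [N a b c] stands for the path built from its three subtrees, and for the
    non-crossing spanning tree whose three parts they are ([word] and
    [tree_set]).  The comparison is a canonical path argument carried out on
    ternary trees: every exchange of two adjacent steps is written as a route
    of O(n) flips, and every flip is shown to lie on O(n) routes.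

    The exchange of an up step with a following down step takes place at a node
    [N a L c], and up to O(1) flips (see [am_route]) its effect on the
    non-crossing tree is to move a subtree one vertex to the right:
    [N a L d] becomes [N L a d].  In both trees the root edge joins the first
    vertex [o] to the vertex [o + |a| + 1]; the part [a] lives on
    [o, ..., o + |a|] in the first and on [o + 1, ..., o + |a| + 1] in the
    second.  With nothing behind the node ([d = L]) this is a slide.  A subtree
    [N a b c] slides by sliding [c], then [b], then [a], and six flips that
    reposition two edges between these phases:
<<
    N (N a b c) L L  -> N a b (N c L L)    ~> N a b (N L c L)
      -> N (N a b L) L c -> N a (N b L L) c ~> N a (N L b L) c
      -> N (N a L L) b c ~> N (N L a L) b c -> N L (N a b L) c
      -> N L (N a b c) L
>>
    So a slide of [a] takes [6 |a|] flips ([linked_slide]).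

    The phases are chosen so that they can be undone.  A nested slide takes
    place inside a third child, a second child or a first child according to
    the phase, and the two siblings of that child are the two parts that are
    not being moved.  Hence an intermediate tree, with the node where the
    current flip happens, determines the whole history once the ancestor at
    which the slide started is known.  When [d] is not empty, the top level uses
    phases that merge [c] and [d]; this loses the place where [c] ends
    ([shift_route]).  The unknown start and the unknown place can be encoded
    together by one number below [n], since adding the size of the moved subtree
    to the size of [c] gives a value smaller than the size of the subtree one
    level higher ([level_split]).  This is the reason why a flip lies on O(n)
    routes only ([sum_shift], [sum_am]).

    By Cauchy-Schwarz ([linked_trans]) the squared differences over all
    exchanges add up to O(n * n) times those over all flips.  An exchange has
    probability [1 / (6 n - 2)], and a flip at least [1 / (n (n + 1)^2)] because
    at most [(n + 1)^2] edges can be added; the ratio of the two forms is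
    therefore at least of order [n^-4].

    The two uniform weights are comparable because both encodings reach
    everything.  For paths this is parsing with a stack ([dyck2_word]); for
    spanning trees it is the decomposition of a non-crossing tree along the
    longest edge at its first vertex ([noncrossing_tree]). *)

(** * Ternary trees and 2-Dyck words *)

Inductive tern := L | N of tern & tern & tern.

Fixpoint tern_eqb (x y : tern) : bool :=
  match x, y with
  | L, L => true
  | N a b c, N a' b' c' => [&& tern_eqb a a', tern_eqb b b' & tern_eqb c c']
  | _, _ => false
  end.

Lemma tern_eqP : Equality.axiom tern_eqb.
Proof.
elim=> [|a IHa b IHb c IHc] [|a' b' c'] /=; try by constructor.
by apply: (iffP and3P) => [[/IHa-> /IHb-> /IHc->]|[<- <- <-]] //;
  split; [apply/IHa|apply/IHb|apply/IHc].
Qed.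

HB.instance Definition _ := hasDecEq.Build tern tern_eqP.

Fixpoint sz (x : tern) : nat :=
  if x is N a b c then (sz a + sz b + sz c).+1 else 0.

Fixpoint tcat (x y : tern) : tern :=
  if x is N a b c then N a b (tcat c y) else y.

Fixpoint word (x : tern) : seq bool :=
  if x is N a b c then true :: word a ++ true :: word b ++ false :: word c
  else [::].

Lemma tcatL x : tcat x L = x.
Proof. by elim: x => //= a _ b _ c ->. Qed.

Lemma tcatA x y z : tcat x (tcat y z) = tcat (tcat x y) z.
Proof. by elim: x => //= a _ b _ c ->. Qed.

Lemma sz_tcat x y : sz (tcat x y) = sz x + sz y.
Proof. by elim: x => //= a _ b _ c ->; lia. Qed.

Lemma tcat_inj x x' y y' :
  tcat x y = tcat x' y' -> sz x = sz x' -> x = x' /\ y = y'.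
Proof.
elim: x x' => [|a _ b _ c IH] [|a' b' c'] //= [-> -> /IH eq_c] /eqP.
by move=> e; have [|-> ->] := eq_c; first by lia.
Qed.

Lemma word_tcat x y : word (tcat x y) = word x ++ word y.
Proof. by elim: x => //= a _ b _ c ->; rewrite -!catA /= -!catA. Qed.

Lemma size_word x : size (word x) = 3 * sz x.
Proof. by elim: x => //= a ha b hb c hc; rewrite !size_cat /= size_cat /=; lia. Qed.

(** A stack [d_h; ...; d_0] holds the trees of the maximal Dyck factors of a prefix
    d_0 up d_1 up ... up d_h of height [h]. *)
Fixpoint run (w : seq bool) (st : seq tern) : seq tern :=
  match w, st with
  | true :: w', _ => run w' (L :: st)
  | false :: w', d2 :: d1 :: d0 :: st' => run w' (tcat d0 (N d1 d2 L) :: st')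
  | _, _ => st
  end.

(** The machine returns the tree from its word, which makes [word] injective. *)
Lemma run_word x w d st : run (word x ++ w) (d :: st) = run w (tcat d x :: st).
Proof.
elim: x w d st => [|a IHa b IHb c IHc] w d st /=; first by rewrite tcatL.
by rewrite -catA IHa /= -catA IHb /= IHc -tcatA.
Qed.

Lemma word_inj : injective word.
Proof.
move=> x y exy.
have := run_word x [::] L [::]; rewrite exy run_word /=; by case.
Qed.

Fixpoint unstack (st : seq tern) : seq bool :=
  match st with
  | [::] => [::]
  | [:: d] => word d
  | d :: st' => unstack st' ++ true :: word d
  end.

Definition height (w : seq bool) : int := (\sum_(b <- w) step b)%R.

Lemma height_cat u v : height (u ++ v) = (height u + height v)%R.
Proof. exact: big_cat. Qed.

Lemma height_cons b v : height (b :: v) = (step b + height v)%R.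
Proof. exact: big_cons. Qed.

Lemma height_nil : height [::] = 0%R.
Proof. exact: big_nil. Qed.

Lemma height_word x : height (word x) = 0%R.
Proof.
elim: x => [|a ha b hb c hc] /=; first exact: height_nil.
by rewrite !(height_cons, height_cat) ha hb hc.
Qed.

Definition nonneg (h : int) (w : seq bool) :=
  forall k, (0 <= h + height (take k w))%R.

Lemma nonneg_cons h b w : nonneg h (b :: w) <->
  (0 <= h)%R /\ nonneg (h + step b) w.
Proof.
split=> [hw|[h0 hw] [|k]] /=; last by rewrite height_cons addrA.
  split=> [|k]; first by have := hw 0; rewrite /= height_nil addr0.
  by have := hw k.+1; rewrite /= height_cons addrA.
by rewrite height_nil addr0.
Qed.

Lemma unstack2 d e st : unstack (d :: e :: st) = unstack (e :: st) ++ true :: word d.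
Proof. by []. Qed.

Lemma unstack_tcat d x st : unstack (tcat d x :: st) = unstack (d :: st) ++ word x.
Proof. by case: st => [|e st] /=; rewrite word_tcat // -catA. Qed.

(** Reading never fails as long as the height, which is the size of the stack minus
    one, stays non-negative. *)
Lemma run_spec w d st : nonneg (size st : int) w ->
  unstack (run w (d :: st)) = unstack (d :: st) ++ w /\
  (size (run w (d :: st)) : int) = ((size st : int) + 1 + height w)%R.
Proof.
elim: w d st => [|[] w IH] d st /=.
- by rewrite cats0 height_nil; split => //; lia.
- move=> /nonneg_cons[_ hw]; have [|-> ->] := IH L (d :: st).
    by move: hw; congr nonneg; rewrite /step /=; lia.
  by rewrite unstack2 -catA /= height_cons /step /=; split=> //; lia.
- move=> /nonneg_cons[_ hw].
  case: st hw => [|d1 [|d0 st]] hw.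
  + by have := hw 0; rewrite take0 height_nil /step /=.
  + by have := hw 0; rewrite take0 height_nil /step /=.
  + have [|-> ->] := IH (tcat d0 (N d1 d L)) st.
      by move: hw; congr nonneg; rewrite /step /=; lia.
    rewrite unstack_tcat !unstack2 height_cons /step /= -!catA /= -!catA /=.
    by rewrite -catA; split=> //; lia.
Qed.

Lemma is_dyck2P w : reflect (nonneg 0 w /\ height w = 0%R) (is_dyck2 w).
Proof.
apply: (iffP andP) => [[/forallP h /eqP e]|[h e]]; split; rewrite /height ?e //.
  move=> k; rewrite add0r; case: (ltnP k (size w).+1) => hk.
    exact: (h (Ordinal hk)).
  by rewrite take_oversize ?/height ?e //; lia.
- by apply/forallP => k; have := h k; rewrite add0r.
- by rewrite -/(height w) e.
Qed.

Lemma dyck2_word w : is_dyck2 w -> exists x, word x = w.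
Proof.
move=> /is_dyck2P[hw h0]; have [e es] := @run_spec w L [::] hw.
move: e es; rewrite h0 /=; case: (run w [:: L]) => [|x [|y s]] //= <- _.
by exists x.
Qed.

Lemma nonneg_cat h u v : nonneg h u -> nonneg (h + height u) v -> nonneg h (u ++ v).
Proof.
move=> hu hv k; rewrite take_cat; case: ifP => _; first exact: hu.
by rewrite height_cat addrA.
Qed.

Lemma nonneg_le h h' w : (h <= h')%R -> nonneg h w -> nonneg h' w.
Proof. by move=> hh hw k; have := hw k; lia. Qed.

Lemma nonneg_word x : nonneg 0 (word x).
Proof.
elim: x => [|a ha b hb c hc] /=; first by move=> [|k]; rewrite /= height_nil.
apply/nonneg_cons; split=> //; apply: nonneg_cat; first exact: nonneg_le ha.
apply/nonneg_cons; rewrite height_word; split=> //.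
apply: nonneg_cat; first exact: nonneg_le hb.
by apply/nonneg_cons; rewrite height_word; split.
Qed.

Lemma word_dyck2 x : is_dyck2 (word x).
Proof. by apply/is_dyck2P; split; [exact: nonneg_word|exact: height_word]. Qed.

(** * Trees with a hole *)

Inductive frame := FA of tern & tern | FB of tern & tern | FC of tern & tern.

Definition frame_code (f : frame) : nat * (tern * tern) :=
  match f with FA b c => (0, (b, c)) | FB a c => (1, (a, c))
             | FC a b => (2, (a, b)) end.

Definition frame_decode (p : nat * (tern * tern)) : frame :=
  let: (k, (x, y)) := p in
  match k with 0 => FA x y | 1 => FB x y | _ => FC x y end.

Lemma frame_codeK : cancel frame_code frame_decode.
Proof. by case. Qed.

HB.instance Definition _ := Equality.copy frame (can_type frame_codeK).

(** The innermost frame comes first. *)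
Definition ctx := seq frame.

Definition fill (f : frame) (x : tern) : tern :=
  match f with FA b c => N x b c | FB a c => N a x c | FC a b => N a b x end.

Fixpoint plug (K : ctx) (x : tern) : tern :=
  if K is f :: K' then plug K' (fill f x) else x.

(** Concatenation with [q] on the left as a context. *)
Fixpoint spine (q : tern) : ctx :=
  if q is N a b c then rcons (spine c) (FC a b) else [::].

(** A node [x] together with its context, that is an occurrence of [x] in
    [plug K x].  Locations stand for the edges of a non-crossing tree. *)
Definition loc : Type := ctx * tern.

Fixpoint nodes (K : ctx) (x : tern) : seq loc :=
  if x is N a b c then
    (K, x) :: nodes (FA b c :: K) a ++ nodes (FB a c :: K) b
           ++ nodes (FC a b :: K) c
  else [::].

Lemma plug_cat K1 K2 x : plug (K1 ++ K2) x = plug K2 (plug K1 x).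
Proof. by elim: K1 x => /=. Qed.

Lemma plug_spine q x : plug (spine q) x = tcat q x.
Proof. by elim: q => //= a _ b _ c IH; rewrite -cats1 plug_cat IH. Qed.

Fixpoint pre (K : ctx) : seq bool :=
  match K with
  | [::] => [::]
  | FA b c :: K' => pre K' ++ [:: true]
  | FB a c :: K' => pre K' ++ true :: word a ++ [:: true]
  | FC a b :: K' => pre K' ++ true :: word a ++ true :: word b ++ [:: false]
  end.

Fixpoint post (K : ctx) : seq bool :=
  match K with
  | [::] => [::]
  | FA b c :: K' => true :: word b ++ false :: word c ++ post K'
  | FB a c :: K' => false :: word c ++ post K'
  | FC a b :: K' => post K'
  end.

Lemma word_plug K x : word (plug K x) = pre K ++ word x ++ post K.
Proof.
elim: K x => [|f K IH] x /=; first by rewrite cats0.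
by case: f => a b; rewrite IH /= -!catA /= -!catA /= -?catA.
Qed.

Lemma pre_spine q K : pre (spine q ++ K) = pre K ++ word q.
Proof.
elim: q K => [|a _ b _ c IH] K /=; first by rewrite cats0.
by rewrite cat_rcons IH /= -!catA /= -!catA /= -!catA.
Qed.

Lemma post_spine q K : post (spine q ++ K) = post K.
Proof. by elim: q K => //= a _ b _ c IH K; rewrite cat_rcons IH. Qed.

Lemma mem_nodes K K' x y : (K', y) \in nodes K x ->
  exists2 st, K' = st ++ K & plug st y = x /\ y != L.
Proof.
elim: x K => [//|a IHa b IHb c IHc] K /=.
rewrite inE !mem_cat => /orP[/eqP[-> ->]|/or3P[/IHa|/IHb|/IHc]].
- by exists [::].
- by case=> st -> [<- ?]; exists (rcons st (FA b c)); rewrite ?cat_rcons // -cats1 plug_cat.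
- by case=> st -> [<- ?]; exists (rcons st (FB a c)); rewrite ?cat_rcons // -cats1 plug_cat.
- by case=> st -> [<- ?]; exists (rcons st (FC a b)); rewrite ?cat_rcons // -cats1 plug_cat.
Qed.

Lemma nodes_fill f K x : {subset nodes (f :: K) x <= nodes K (fill f x)}.
Proof.
by case: f => a b p /= hp; rewrite inE !mem_cat hp ?orbT.
Qed.

Lemma nodes_plug st K y : y != L -> (st ++ K, y) \in nodes K (plug st y).
Proof.
move=> yL; suff sub x : {subset nodes (st ++ K) x <= nodes K (plug st x)}.
  by apply: sub; case: y yL => //= a b c _; rewrite inE eqxx.
elim: st x => [|f st IH] x p //= hp; exact/IH/nodes_fill.
Qed.

(** The longest left concatenation at the innermost end of a context; what remains
    starts with the parent whose first or second child contains the hole. *)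
Fixpoint strip (K : ctx) : tern * ctx :=
  if K is FC a b :: K' then
    let: (q, K0) := strip K' in (tcat q (N a b L), K0)
  else (L, K).

Lemma spine_tcat q r : spine (tcat q r) = spine r ++ spine q.
Proof. by elim: q => [|a _ b _ c IH] /=; rewrite ?cats0 // IH rcons_cat. Qed.

Lemma strip_spine q f K : (if f is FC _ _ then false else true) ->
  strip (spine q ++ f :: K) = (q, f :: K).
Proof.
move=> hf; suff h K0 r : strip K0 = (r, f :: K) -> 
    strip (spine q ++ K0) = (tcat r q, f :: K).
  by apply: (h _ L); case: f hf {h}.
elim: q K0 r => [|a _ b _ c IH] K0 r h /=; first by rewrite tcatL.
by rewrite cat_rcons (IH _ (tcat r (N a b L))) /= ?h // -tcatA.
Qed.

Lemma strip_cat K : spine (strip K).1 ++ (strip K).2 = K.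
Proof.
elim: K => [|[a b|a b|a b] K IH] //=; case: (strip K) IH => q K0 /= <-.
by rewrite spine_tcat.
Qed.

Lemma strip_frame K : if (strip K).2 is FC _ _ :: _ then False else True.
Proof. by elim: K => [|[a b|a b|a b] K IH] //=; case: (strip K) IH. Qed.

Lemma cat_eq_split (T : Type) (u v x z : seq T) : u ++ v = x ++ z ->
  (exists2 x', x = u ++ x' & v = x' ++ z) \/
  (exists2 u', u = x ++ u' & z = u' ++ v).
Proof.
elim: u x => [|p u IH] [|q x] /=.
- by move=> ->; left; exists [::].
- by move=> ->; left; exists (q :: x).
- by move=> <-; right; exists (p :: u).
case=> -> /IH[[x' -> ->]|[u' -> ->]]; [by left; exists x'|by right; exists u'].
Qed.

Lemma pre_cat K1 K2 : pre (K1 ++ K2) = pre K2 ++ pre K1.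
Proof.
by elim: K1 => [|[a b|a b|a b] K IH] /=; rewrite ?cats0 // IH -!catA.
Qed.

Lemma post_cat K1 K2 : post (K1 ++ K2) = post K1 ++ post K2.
Proof.
by elim: K1 => [|[a b|a b|a b] K IH] //=; rewrite IH -!catA /= -?catA.
Qed.

(** Otherwise the prefix [u] would have height [-1]. *)
Lemma word_last x u : word x <> rcons u true.
Proof.
move=> e; have := nonneg_word x (size u); have := height_word x.
rewrite e -cats1 take_size_cat // height_cat height_cons height_nil /step; lia.
Qed.

(** A peak of the word is the second up step and the down step of a node whose
    second subtree is empty: that up step cannot be followed by a word of the
    second subtree, and no word ends with an up step. *)
Lemma locate x u v : word x = u ++ [:: true, false & v] ->
  exists K a c, [/\ x = plug K (N a L c), u = pre K ++ true :: word a &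
                    v = word c ++ post K].
Proof.
elim: x u v => [|a IHa b IHb c IHc] [|s u] v //=; first by case: a {IHa} => [|? ? ?].
case=> <- /cat_eq_split[[u1 ->]|[w ea ew]].
  case: u1 => [|s1 u1] /= [].
    case: b {IHb} => [|? ? ?] //= -[ev]; exists [::], a, c.
    by rewrite /= cats0 ev cats0.
  move=> <- /cat_eq_split[[u2 ->]|[w eb ew]].
    case: u2 => [|s2 u2] //= [<- /IHc[K [a' [c' [-> -> ->]]]]].
    exists (rcons K (FC a b)), a', c'; rewrite -cats1 plug_cat pre_cat post_cat.
    by rewrite /= -?catA /= -?catA /= -?catA /= -?catA ?cats0.
  case: w ew eb => [|r1 [|r2 w]] //= [<-]; first by rewrite cats1 => _ /word_last.
  case=> <- -> /IHb[K [a' [c' [-> -> ->]]]].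
  exists (rcons K (FB a c)), a', c'; rewrite -cats1 plug_cat pre_cat post_cat.
  by rewrite /= -?catA /= -?catA /= -?catA ?cats0.
case: w ew ea => [|r1 [|r2 w]] //=.
  case: b {IHb} => [|? ? ?] //= -[ev]; rewrite cats0 => <-; exists [::], a, c.
  by rewrite /= ev cats0.
case=> <- <- -> /IHa[K [a' [c' [-> -> ->]]]].
exists (rcons K (FA b c)), a', c'; rewrite -cats1 plug_cat pre_cat post_cat.
by rewrite /= -?catA /= -?catA /= -?catA ?cats0.
Qed.

(** * Edges of the non-crossing tree *)

Fixpoint arcs (o : nat) (x : tern) : seq (nat * nat) :=
  if x is N a b c then
    (o, o + sz a + 1 + sz b) :: arcs o a ++ arcs (o + sz a + 1) b
      ++ arcs (o + sz a + 1 + sz b) c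
  else [::].

(** The leftmost vertex of the tree that fills the hole; it does not depend on
    that tree, and so a flip inside the hole does not disturb the edges outside. *)
Fixpoint off (K : ctx) : nat :=
  match K with
  | [::] => 0
  | FA b c :: K' => off K'
  | FB a c :: K' => off K' + sz a + 1
  | FC a b :: K' => off K' + sz a + 1 + sz b
  end.

(** The pair for [L] is a dummy value. *)
Definition root_arc (K : ctx) (x : tern) : nat * nat :=
  if x is N a b c then (off K, off K + sz a + 1 + sz b) else (0, 0).

Definition fsz (f : frame) : nat :=
  match f with FA x y | FB x y | FC x y => sz x + sz y + 1 end.

Fixpoint csz (K : ctx) : nat := if K is f :: K' then csz K' + fsz f else 0.

Lemma sz_plug K x : sz (plug K x) = csz K + sz x.
Proof. by elim: K x => [|[a b|a b|a b] K IH] x //=; rewrite IH /=; lia. Qed.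

Lemma csz_spine q K : csz (spine q ++ K) = csz K + sz q.
Proof.
by elim: q K => [|a _ b _ c IH] K //=; rewrite ?addn0 // cat_rcons IH /=; lia.
Qed.

Lemma off_spine q K : off (spine q ++ K) = off K + sz q.
Proof.
by elim: q K => [|a _ b _ c IH] K //=; rewrite ?addn0 // cat_rcons IH /=; lia.
Qed.

Lemma arcs_tcat o x y : arcs o (tcat x y) = arcs o x ++ arcs (o + sz x) y.
Proof.
elim: x o => [|a _ b _ c IH] o /=; first by rewrite addn0.
by rewrite IH -!catA; congr (_ :: _ ++ _ ++ _ ++ arcs _ _); lia.
Qed.

(** Nodes and edges correspond one to one, in the same order. *)
Lemma root_arcs K x : map (fun z => root_arc z.1 z.2) (nodes K x) = arcs (off K) x.
Proof.
by elim: x K => [|a IHa b IHb c IHc] K //=; rewrite !map_cat IHa IHb IHc.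
Qed.

Lemma arcs_range o x i j : (i, j) \in arcs o x -> o <= i < j /\ j <= o + sz x.
Proof.
elim: x o => [|a IHa b IHb c IHc] o //=; rewrite inE !mem_cat.
by case/or4P => [/eqP[-> ->]|/IHa[]|/IHb[]|/IHc[]]; lia.
Qed.

Lemma uniq_arcs o x : uniq (arcs o x).
Proof.
elim: x o => [|a IHa b IHb c IHc] o //=; rewrite !cat_uniq IHa IHb IHc /= !andbT.
rewrite !mem_cat; apply/and3P; split.
- by apply/negP => /or3P[] /arcs_range; lia.
- by apply/hasPn => -[i j]; rewrite mem_cat => /orP[] /arcs_range h;
     apply/negP => /arcs_range; lia.
- by apply/hasPn => -[i j] /arcs_range h; apply/negP => /arcs_range; lia.
Qed.

Lemma uniq_nodes K x : uniq (nodes K x).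
Proof. by apply: (@map_uniq _ _ (fun z => root_arc z.1 z.2)); rewrite root_arcs uniq_arcs. Qed.

(** Equality of two multisets of edges up to the form of their endpoints: compare
    the counts of an arbitrary predicate after identifying equal vertex numbers. *)
Ltac perm_arcs :=
  apply/permP; let p := fresh "p" in intro p; rewrite /root_arc;
  repeat progress rewrite /= ?(arcs_tcat, off_spine, count_cat, sz_tcat, addn0);
  repeat match goal with
  | |- context [arcs ?x ?c] =>
    match goal with
    | |- context [arcs ?y c] => tryif constr_eq x y then fail else
        (replace y with x by (clear; lia))
    end
  | |- context [p (?x, ?y)] =>
    match goal with
    | |- context [p (?x', ?y')] =>
        tryif (constr_eq x x'; constr_eq y y') then fail else
        (replace (p (x', y')) with (p (x, y)) by (clear; congr (p (_, _)); lia))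
    end
  end; lia.

(** The edges outside a hole filled by a tree of size [m]. *)
Fixpoint carcs (K : ctx) (m : nat) : seq (nat * nat) :=
  match K with
  | [::] => [::]
  | FA b c :: K' => (off K', off K' + m + 1 + sz b)
     :: arcs (off K' + m + 1) b ++ arcs (off K' + m + 1 + sz b) c
     ++ carcs K' (m + sz b + sz c).+1
  | FB a c :: K' => (off K', off K' + sz a + 1 + m)
     :: arcs (off K') a ++ arcs (off K' + sz a + 1 + m) c
     ++ carcs K' (sz a + m + sz c).+1
  | FC a b :: K' => (off K', off K' + sz a + 1 + sz b)
     :: arcs (off K') a ++ arcs (off K' + sz a + 1) b
     ++ carcs K' (sz a + sz b + m).+1
  end.

Lemma arcs_plug K x : perm_eq (arcs 0 (plug K x)) (arcs (off K) x ++ carcs K (sz x)).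
Proof.
elim: K x => [|f K IH] x /=; first by rewrite cats0.
by case: f => a b; apply: (perm_trans (IH _)) => /=; perm_arcs.
Qed.

(** * Flips and routes of flips *)

Section Routes.
Variables (R : realFieldType) (n : nat) (F : tern -> R) (cost : loc -> R).
Local Open Scope ring_scope.

Hypothesis cost_ge0 : forall z, 0 <= cost z.
Hypothesis cost_flip : forall K x y e', x != L -> sz (plug K x) = n -> sz y = n ->
  perm_eq (e' :: arcs 0 (plug K x)) (root_arc K x :: arcs 0 y) ->
  (F (plug K x) - F y) ^+ 2 <= cost (K, x).

(** What a route from [x] to [y] through the flips at the locations [l] yields.
    The factor [size l] is that of Cauchy-Schwarz; in this form the order of the
    flips is irrelevant and routes can be concatenated. *)
Definition linked (l : seq loc) (x y : tern) : Prop :=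
  (F x - F y) ^+ 2 <= (size l)%:R * \sum_(z <- l) cost z.

Lemma linked_refl x : linked [::] x x.
Proof. by rewrite /linked subrr expr0n mul0r. Qed.

Lemma linked_sym l x y : linked l x y -> linked l y x.
Proof. by rewrite /linked -sqrrN opprB. Qed.

Lemma linked_perm l1 l2 x y : perm_eq l1 l2 -> linked l1 x y -> linked l2 x y.
Proof. by move=> p; rewrite /linked (perm_size p) (perm_big _ p). Qed.

(** Cauchy-Schwarz in the form (u + v)^2 <= (p + q) (u^2 / p + v^2 / q), where [p]
    and [q] are the two lengths. *)
Lemma linked_trans y l1 l2 x z : linked l1 x y -> linked l2 y z -> linked (l1 ++ l2) x z.
Proof.
rewrite /linked size_cat big_cat /= natrD.
have s1 : 0 <= \sum_(z <- l1) cost z by exact: sumr_ge0.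
have s2 : 0 <= \sum_(z <- l2) cost z by exact: sumr_ge0.
move: (\sum_(z <- l1) _) (\sum_(z <- l2) _) s1 s2 => S1 S2 s1 s2 h1 h2.
have -> : F x - F z = (F x - F y) + (F y - F z) by ring.
move: h1 h2; set u := F x - F y; set v := F y - F z.
have m1 : 0 <= (size l1)%:R :> R by [].
have m2 : 0 <= (size l2)%:R :> R by [].
case: (size l1) (size l2) m1 m2 => [|k1] [|k2] m1 m2.
- rewrite !mul0r add0r mul0r => h1 h2.
  have u0 : u = 0 by apply/eqP; rewrite -sqrf_eq0 eq_le h1 sqr_ge0.
  have v0 : v = 0 by apply/eqP; rewrite -sqrf_eq0 eq_le h2 sqr_ge0.
  by rewrite u0 v0 addr0 expr0n.
- rewrite mul0r add0r => h1 h2.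
  have u0 : u = 0 by apply/eqP; rewrite -sqrf_eq0 eq_le h1 sqr_ge0.
  rewrite u0 add0r; nra.
- rewrite mul0r addr0 => h1 h2.
  have v0 : v = 0 by apply/eqP; rewrite -sqrf_eq0 eq_le h2 sqr_ge0.
  rewrite v0 addr0; nra.
move: (k1.+1%:R) (k2.+1%:R) (ltr0Sn R k1) (ltr0Sn R k2) => M1 M2 M1p M2p h1 h2.
have hu : u ^+ 2 / M1 <= S1 by rewrite ler_pdivrMr // mulrC.
have hv : v ^+ 2 / M2 <= S2 by rewrite ler_pdivrMr // mulrC.
have key : (u + v) ^+ 2 <= (M1 + M2) * (u ^+ 2 / M1 + v ^+ 2 / M2).
  rewrite -subr_ge0.
(* Lagrange's identity for two terms *)
  have -> : (M1 + M2) * (u ^+ 2 / M1 + v ^+ 2 / M2) - (u + v) ^+ 2 =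
     (M2 * u - M1 * v) ^+ 2 / (M1 * M2) by field; rewrite !gt_eqF.
  by rewrite divr_ge0 ?sqr_ge0 ?mulr_ge0 ?ltW.
apply: le_trans key _; apply: ler_wpM2l; last exact: lerD.
by apply: addr_ge0; apply: ltW.
Qed.

(** A flip may be checked inside a hole, because the edges outside depend only on
    the size of the tree that fills it. *)
Lemma linked_flip K' x K s t e' :
  plug K' x = plug K s -> x != L -> sz (plug K s) = n -> sz s = sz t ->
  perm_eq (e' :: arcs (off K) s) (root_arc K' x :: arcs (off K) t) ->
  linked [:: (K', x)] (plug K s) (plug K t).
Proof.
move=> eK xL en est pe; rewrite /linked /= big_seq1 mul1r -eK.
apply: (cost_flip (e' := e')) => //; first by rewrite eK.
  by rewrite -en !sz_plug est.
have h1 := arcs_plug K s; have h2 := arcs_plug K t; rewrite eK.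
apply: (@perm_trans _ (e' :: arcs (off K) s ++ carcs K (sz s))).
  by rewrite perm_cons.
rewrite est; apply: (@perm_trans _ (root_arc K' x :: arcs (off K) t ++ carcs K (sz t))).
  by rewrite -!cat_cons perm_cat2r.
by rewrite perm_cons perm_sym.
Qed.

(** The argument is the edge that enters; the edge that leaves is the root edge of
    the location. *)
Ltac flip e :=
  apply: (linked_flip (e' := e)) => //;
  first [ by rewrite ?plug_cat ?plug_spine
        | by rewrite ?sz_plug /= ?sz_tcat /=; lia
        | by perm_arcs ].

(** The root edge swings to the end of an earlier prime of the second subtree. *)
Lemma flip_tail K a b c d : sz (plug K (N a (tcat b c) d)) = n ->
  linked [:: (K, N a (tcat b c) d)]
    (plug K (N a (tcat b c) d)) (plug K (N a b (tcat c d))).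
Proof. by rewrite sz_plug /= ?sz_tcat /= => en; flip (off K, off K + sz a + 1 + sz b)%N. Qed.

Lemma flip_open K a b c d : sz (plug K (N (N a b c) L d)) = n ->
  linked [:: (FA L d :: K, N a b c)] (plug K (N (N a b c) L d))
    (plug K (N a (tcat b (N c L L)) d)).
Proof.
by rewrite sz_plug /= ?sz_tcat /= => en; flip (off K + sz a + 1 + sz b, off K + sz a + sz b + sz c + 2)%N.
Qed.

Lemma flip_open0 K a b c : sz (plug K (N (N a b c) L L)) = n ->
  linked [:: (K, N (N a b c) L L)] (plug K (N (N a b c) L L))
    (plug K (N a b (N c L L))).
Proof.
by rewrite sz_plug /= ?sz_tcat /= => en; flip (off K + sz a + 1 + sz b, off K + sz a + sz b + sz c + 2)%N.
Qed.

Lemma flip_close0 K a b c : sz (plug K (N (N a b L) L c)) = n ->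
  linked [:: (K, N (N a b L) L c)] (plug K (N (N a b L) L c))
    (plug K (N a b (N L c L))).
Proof.
by rewrite sz_plug /= ?sz_tcat /= => en; flip (off K + sz a + 1 + sz b, off K + sz a + sz b + sz c + 2)%N.
Qed.

Lemma flip_mid0 K a b c : sz (plug K (N (N a b L) L c)) = n ->
  linked [:: (FA L c :: K, N a b L)] (plug K (N (N a b L) L c))
    (plug K (N a (N b L L) c)).
Proof.
by rewrite sz_plug /= ?sz_tcat /= => en; flip (off K + sz a + 1, off K + sz a + sz b + 2)%N.
Qed.

Lemma flip_mid K a b c d : sz (plug K (N a (N b L c) d)) = n ->
  linked [:: (FB a d :: K, N b L c)] (plug K (N a (N b L c) d))
    (plug K (N a (tcat b (N L c L)) d)).
Proof.
by rewrite sz_plug /= ?sz_tcat /= => en; flip (off K + sz a + 1 + sz b, off K + sz a + sz b + sz c + 2)%N.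
Qed.

Lemma flip_left K a b c : sz (plug K (N a (N L b L) c)) = n ->
  linked [:: (FB a c :: K, N L b L)] (plug K (N a (N L b L) c))
    (plug K (N (N a L L) b c)).
Proof. by rewrite sz_plug /= ?sz_tcat /= => en; flip (off K, off K + sz a + 1)%N. Qed.

Lemma flip_right K a b c : sz (plug K (N (N L a L) b c)) = n ->
  linked [:: (FA b c :: K, N L a L)] (plug K (N (N L a L) b c))
    (plug K (N L (N a b L) c)).
Proof. by rewrite sz_plug /= ?sz_tcat /= => en; flip (off K + 1, off K + sz a + sz b + 2)%N. Qed.

(** The locations of the six flips between the phases of a slide of [N a b c].
    Each of them determines the context and the three subtrees. *)
Definition slide_flips (z : loc) : seq loc :=
  if z.2 is N a b c then
    let K := z.1 in
    [:: (K, N (N a b c) L L); (K, N (N a b L) L c); (FA L c :: K, N a b L);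
        (FB a c :: K, N L b L); (FA b c :: K, N L a L); (K, N L (N a b c) L)]
  else [::].

Definition slide_route (K : ctx) (x : tern) : seq loc :=
  flatten (map slide_flips (nodes K x)).

Lemma size_slide K x : size (slide_route K x) = (6 * sz x)%N.
Proof.
rewrite /slide_route; elim: x K => [|a IHa b IHb c IHc] K //=.
by rewrite !map_cat !flatten_cat !size_cat IHa IHb IHc; lia.
Qed.

Lemma linked_slide K x : sz (plug K (N x L L)) = n ->
  linked (slide_route K x) (plug K (N x L L)) (plug K (N L x L)).
Proof.
elim: x K => [|a IHa b IHb c IHc] K en; first exact: linked_refl.
have en' : (csz K + sz a + sz b + sz c + 2)%N = n.
  by move: en; rewrite sz_plug /=; lia.
(* the same locations in the order of the route; a slide of each part is
   nested between the flips of the node *)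
apply: (@linked_perm ([:: (K, N (N a b c) L L)] ++ (slide_route (FC a b :: K) c ++
  ([:: (K, N (N a b L) L c)] ++ ([:: (FA L c :: K, N a b L)] ++
   (slide_route (FB a c :: K) b ++ ([:: (FB a c :: K, N L b L)] ++
    (slide_route (FA b c :: K) a ++ ([:: (FA b c :: K, N L a L)] ++
      [:: (K, N L (N a b c) L)]))))))))).
  apply/permP => p; rewrite /slide_route /= !map_cat !flatten_cat !count_cat /=.
  rewrite ?count_cat /= ?count_cat /= ?count_cat /= ?count_cat /= ?count_cat /=; lia.
have sz1 y : sz y = (sz a + sz b + sz c + 2)%N -> sz (plug K y) = n.
  by rewrite sz_plug => ->; lia.
apply: (linked_trans (flip_open0 (sz1 _ _))); first by rewrite /=; lia.
apply: (linked_trans (IHc (FC a b :: K) (sz1 _ _))); first by rewrite /=; lia.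
apply: (linked_trans (linked_sym (flip_close0 (sz1 _ _)))); first by rewrite /=; lia.
apply: (linked_trans (flip_mid0 (sz1 _ _))); first by rewrite /=; lia.
apply: (linked_trans (IHb (FB a c :: K) (sz1 _ _))); first by rewrite /=; lia.
apply: (linked_trans (flip_left (sz1 _ _))); first by rewrite /=; lia.
apply: (linked_trans (IHa (FA b c :: K) (sz1 _ _))); first by rewrite /=; lia.
apply: (linked_trans (flip_right (sz1 _ _))); first by rewrite /=; lia.
apply: linked_sym; have := @flip_tail K L (N a b L) c L.
by rewrite /= tcatL; apply; apply: sz1; rewrite /=; lia.
Qed.

(** At the top level the part [d] behind the node is not empty.  The first phase
    keeps it apart by sliding [c] at the end of the second subtree; the other two
    phases slide [b] and [a] in front of the merged part [tcat c d].  All slides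
    then have nothing behind the moved subtree, as the nested recursion requires. *)
Definition shift_route (z : loc) : seq loc :=
  if z.2 is N (N a b c) L d then
    let K := z.1 in
    [:: (FA L d :: K, N a b c)] ++ slide_route (spine b ++ FB a d :: K) c ++
    [:: (FB a d :: K, N b L c)] ++ [:: (K, N a (N b L c) d)] ++
    slide_route (FB a (tcat c d) :: K) b ++ [:: (FB a (tcat c d) :: K, N L b L)] ++
    slide_route (FA b (tcat c d) :: K) a ++ [:: (FA b (tcat c d) :: K, N L a L)] ++
    [:: (K, N L (N a b c) d)]
  else [::].

Lemma linked_shift K a d : sz (plug K (N a L d)) = n ->
  linked (shift_route (K, N a L d)) (plug K (N a L d)) (plug K (N L a d)).
Proof.
case: a => [|a b c] en; first exact: linked_refl.
have en' : (csz K + sz a + sz b + sz c + sz d + 2)%N = n.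
  by move: en; rewrite sz_plug /=; lia.
have sz1 y : sz y = (sz a + sz b + sz c + sz d + 2)%N -> sz (plug K y) = n.
  by rewrite sz_plug => ->; lia.
have e1 : linked (slide_route (spine b ++ FB a d :: K) c)
    (plug K (N a (tcat b (N c L L)) d)) (plug K (N a (tcat b (N L c L)) d)).
  have := @linked_slide (spine b ++ FB a d :: K) c.
  rewrite !plug_cat !plug_spine; apply; apply: sz1.
  by rewrite /= sz_tcat /=; lia.
rewrite /shift_route /=.
apply: (linked_trans (flip_open (sz1 _ _))); first by rewrite /=; lia.
apply: (linked_trans e1).
apply: (linked_trans (linked_sym (flip_mid (sz1 _ _)))); first by rewrite /=; lia.
apply: (@linked_trans (plug K (N a (N b L L) (tcat c d))) [:: (K, N a (N b L c) d)]).
  have := @flip_tail K a (N b L L) c d; apply; apply: sz1; rewrite /=; lia.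
apply: (linked_trans (linked_slide (K := FB a (tcat c d) :: K) (sz1 _ _))).
  by rewrite /= sz_tcat; lia.
apply: (linked_trans (flip_left (sz1 _ _))); first by rewrite /= sz_tcat; lia.
apply: (linked_trans (linked_slide (K := FA b (tcat c d) :: K) (sz1 _ _))).
  by rewrite /= sz_tcat; lia.
apply: (linked_trans (flip_right (sz1 _ _))); first by rewrite /= sz_tcat; lia.
apply: linked_sym; have := @flip_tail K L (N a b L) c d; apply.
by apply: sz1; rewrite /=; lia.
Qed.

Lemma size_shift K x : (size (shift_route (K, x)) <= 6 * sz x)%N.
Proof.
case: x => [//|[//|a b c] [|//] d].
by rewrite /shift_route !size_cat !size_slide /=; lia.
Qed.

(** The hole lies on a spine [q] inside the first child ([FA]) or the second child
    ([FB]) of some node; without such a node the exchanged word would go below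
    zero, and the value is a dummy. *)
Definition am_target (z : loc) : tern :=
  if z is (K, N a L c) then
    match strip K with
    | (q, FA b' c' :: K0) => plug K0 (N q a (N c b' c'))
    | (q, FB a' c' :: K0) => plug K0 (N (tcat a' (N q a L)) c c')
    | _ => plug K (N a L c)
    end
  else plug z.1 z.2.

(** In the first case the subtree [a] is shifted and two flips bring the root
    edges in place.  In the second case [q] has to move one vertex to the left
    while [a] stays, so a shift is run backwards between two flips. *)
Definition am_route (z : loc) : seq loc :=
  if z is (K, N a L c) then
    match strip K with
    | (q, FA b' c' :: K0) => shift_route z ++
       [:: (K0, N (tcat q (N L a c)) b' c')] ++ [:: (K0, N q a (N c b' c'))]
    | (q, FB a' c' :: K0) => [:: z] ++
       shift_route (spine a' ++ FA c c' :: K0, N q L a) ++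
       [:: (spine a' ++ FA c c' :: K0, N q L a)]
    | _ => [::]
    end
  else [::].

Lemma linked_am z : sz (plug z.1 z.2) = n ->
  linked (am_route z) (plug z.1 z.2) (am_target z).
Proof.
case: z => K [|a [|? ? ?] c] en /=; try exact: linked_refl.
have := strip_cat K; case: (strip K) => q K1 /= eK.
case: K1 eK => [|[b' c'|a' c'|? ?] K0] eK; try exact: linked_refl.
- apply: (linked_trans (linked_shift en)); rewrite -eK plug_cat plug_spine /=.
  rewrite -eK sz_plug csz_spine /= in en.
  apply: (@linked_trans (plug K0 (tcat q (N L a (N c b' c')))) [:: _]).
    flip (off K0 + sz q + sz a + 1, off K0 + sz q + 2 + sz a + sz c + sz b')%N.
  apply: linked_sym.
  flip (off K0 + sz q, off K0 + sz q + sz a + 1)%N.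
- rewrite -eK plug_cat plug_spine /=.
  rewrite -eK sz_plug csz_spine /= in en.
  apply: (@linked_trans (plug K0 (N (tcat a' (N L q a)) c c')) [:: _]).
    flip (off K0 + sz a', off K0 + sz a' + sz q + 1)%N.
  have := @linked_shift (spine a' ++ FA c c' :: K0) q a.
  rewrite !plug_cat !plug_spine /= => h.
  apply: (linked_trans (linked_sym (h _))).
    by rewrite sz_plug /= sz_tcat /=; lia.
  flip (off K0 + sz a', off K0 + sz a' + sz q + sz a + 1)%N.
Qed.

Lemma size_am z : sz (plug z.1 z.2) = n -> (size (am_route z) <= 6 * n + 2)%N.
Proof.
case: z => K [|a [|? ? ?] c] //; rewrite sz_plug /am_route -/am_route.
have := strip_cat K; case: (strip K) => q K1 /= eK.
case: K1 eK => [|[b' c'|a' c'|? ?] K0] // <-; rewrite csz_spine /= => en.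
- have := size_shift (spine q ++ FA b' c' :: K0) (N a L c).
  by rewrite !size_cat; move: (size (shift_route _)) => k /=; lia.
- have := size_shift (spine a' ++ FA c c' :: K0) (N q L a).
  by rewrite -cat1s !size_cat; move: (size (shift_route _)) => k /=; lia.
Qed.

End Routes.

(** * Counting the routes through a flip *)

Definition trees (n : nat) : seq tern :=
  [seq x <- undup [seq head L (run (val w) [:: L]) | w : (3 * n).-tuple bool]
     | sz x == n].

Lemma mem_trees n x : (x \in trees n) = (sz x == n).
Proof.
rewrite mem_filter mem_undup; apply: andb_idr => /eqP en.
have ew : size (word x) == 3 * n by rewrite size_word en.
apply/mapP; exists (Tuple ew); first by rewrite mem_enum.
by have := run_word x [::] L [::]; rewrite cats0 /= => ->.
Qed.

Lemma uniq_trees n : uniq (trees n).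
Proof. by rewrite filter_uniq ?undup_uniq. Qed.

Definition locs (n : nat) : seq loc := flatten (map (nodes [::]) (trees n)).

Lemma mem_locs n K x : ((K, x) \in locs n) = (x != L) && (sz (plug K x) == n).
Proof.
apply/flattenP/andP => [[_ /mapP[y + ->] /mem_nodes[st ->]]|[xL en]].
  by rewrite mem_trees cats0 => ? [-> ->].
exists (nodes [::] (plug K x)); first by rewrite map_f ?mem_trees.
by rewrite -{1}[K]cats0 nodes_plug.
Qed.

Lemma uniq_locs n : uniq (locs n).
Proof.
rewrite /locs; have := uniq_trees n; elim: (trees n) => //= x s IH /andP[xs us].
rewrite cat_uniq uniq_nodes IH //= andbT; apply/hasPn => -[K z].
move=> /flattenP[_ /mapP[y ys ->] /mem_nodes[st]]; rewrite cats0 => -> [ey _].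
apply/negP => /mem_nodes[st']; rewrite cats0 => <- [ex _].
by move: xs; rewrite -ex ey ys.
Qed.

Lemma fsz_gt0 f : 0 < fsz f.
Proof. by case: f => a b /=; lia. Qed.

(** The sizes of the trees plugged in the inner parts grow strictly with the depth
    of the cut. *)
Lemma ctx_split st1 st2 r1 r2 : st1 ++ r1 = st2 ++ r2 :> ctx ->
  csz st1 = csz st2 -> st1 = st2 /\ r1 = r2.
Proof.
elim: st1 st2 => [|f1 st1 IH] [|f2 st2] //=.
- by move=> _; have := fsz_gt0 f2; lia.
- by move=> _; have := fsz_gt0 f1; lia.
by case=> -> /IH {}IH es; have [|-> ->] := IH; first by lia.
Qed.

(** One number encodes two unknowns, the depth of a frame and a position in it: the
    values [csz st + k] with [k < fsz f] lie in disjoint intervals for different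
    depths. *)
Lemma level_split st1 st2 f1 f2 K1 K2 k1 k2 :
  st1 ++ f1 :: K1 = st2 ++ f2 :: K2 :> ctx -> csz st1 + k1 = csz st2 + k2 ->
  k1 < fsz f1 -> k2 < fsz f2 -> [/\ st1 = st2, f1 = f2, K1 = K2 & k1 = k2].
Proof.
elim: st1 st2 => [|g1 st1 IH] [|g2 st2] //=.
- by case=> -> ->; rewrite !add0n.
- by case=> -> _; lia.
- by case=> -> _; lia.
by case=> -> /IH {}IH es ? ?; have [|//|//|-> -> -> ->] := IH; first by lia.
Qed.

Section Counting.
Variable R : realFieldType.
Local Open Scope ring_scope.

(** The map [phi] need not be injective, but [c] separates the points of each
    fibre, so that no fibre has more than [m] points. *)
Lemma sum_inj_le (I J : eqType) (s : seq I) (t : seq J) (phi : I -> J)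
    (c : I -> nat) (m : nat) (G : J -> R) :
  uniq s -> uniq t -> (forall j, 0 <= G j) ->
  (forall i, i \in s -> phi i \in t /\ (c i < m)%N) ->
  (forall i1 i2, i1 \in s -> i2 \in s -> phi i1 = phi i2 -> c i1 = c i2 -> i1 = i2) ->
  \sum_(i <- s) G (phi i) <= m%:R * \sum_(j <- t) G j.
Proof.
move=> us ut G0 st inj.
have -> : m%:R * \sum_(j <- t) G j =
   \sum_(p <- [seq (j, k) | j <- t, k <- iota 0 m]) G p.1.
  rewrite big_allpairs_dep mulr_sumr; apply: eq_bigr => j _ /=.
  by rewrite big_const_seq iter_addr_0 count_predT size_iota mulr_natl.
rewrite -[X in X <= _](big_map (fun i => (phi i, c i)) xpredT (fun p => G p.1)).
set u := map _ s; set v := [seq _ | _ <- t, _ <- _].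
have uu : uniq u.
  by rewrite map_inj_in_uniq // => i1 i2 h1 h2 [e1 e2]; apply: inj.
have uv : uniq v by rewrite allpairs_uniq ?iota_uniq // => -[? ?] [? ?].
have suv : {subset u <= v}.
  move=> _ /mapP[i /st[h1 h2] ->]; apply/allpairsP; exists (phi i, c i).
  by rewrite mem_iota.
have pv : perm_eq v (u ++ [seq p <- v | p \notin u]).
  apply: uniq_perm => //.
    rewrite cat_uniq uu filter_uniq // andbT.
    by apply/hasPn => p; rewrite mem_filter => /andP[].
  move=> p; rewrite mem_cat mem_filter; case: (boolP (p \in u)) => //= /suv.
  by [].
by rewrite (perm_big _ pv) big_cat /= lerDl; apply: sumr_ge0.
Qed.

Lemma sum_sub_le (I J : eqType) (s : seq I) (t : seq J) (sub : I -> seq J)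
    (c : I -> nat) (m : nat) (G : J -> R) :
  uniq s -> uniq t -> (forall j, 0 <= G j) ->
  (forall i, i \in s -> uniq (sub i)) ->
  (forall i j, i \in s -> j \in sub i -> j \in t /\ (c i < m)%N) ->
  (forall i1 i2 j, i1 \in s -> i2 \in s -> j \in sub i1 -> j \in sub i2 ->
     c i1 = c i2 -> i1 = i2) ->
  \sum_(i <- s) \sum_(j <- sub i) G j <= m%:R * \sum_(j <- t) G j.
Proof.
move=> us ut G0 usub st inj.
rewrite -(big_allpairs_dep (h := pair) (F := fun p : I * J => G p.2)).
apply: (sum_inj_le (phi := snd) (c := fun p => c p.1)) => //.
- by apply: allpairs_uniq_dep => // -[? ?] [? ?] _ _ [-> ->].
- by move=> _ /allpairsPdep[i [j [/st h /h[? ?] ->]]].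
- move=> _ _ /allpairsPdep[i1 [j1 [h1 h2 ->]]] /allpairsPdep[i2 [j2 [h3 h4 ->]]] /=.
  by move=> ej ec; subst j2; rewrite (inj i1 i2 j1).
Qed.

Lemma sum_map_le (I J : eqType) (s : seq I) (t : seq J) (phi : I -> J)
    (G : J -> R) :
  uniq s -> uniq t -> (forall j, 0 <= G j) -> {in s, forall i, phi i \in t} ->
  {in s &, injective phi} -> \sum_(i <- s) G (phi i) <= \sum_(j <- t) G j.
Proof.
move=> us ut G0 st inj; rewrite -[leRHS]mul1r.
by apply: (sum_inj_le (phi := phi) (c := fun=> 0%N) (m := 1%N)) => // [i /st|i1 i2 h1 h2 /inj->].
Qed.

Variables (n : nat) (G : loc -> R).
Hypothesis G0 : forall z, 0 <= G z.
Local Notation total := (\sum_(z <- locs n) G z).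

Lemma total_ge0 : 0 <= total. Proof. exact: sumr_ge0. Qed.

Lemma sum_slide_flips (m : nat) : n = m.+1 ->
  \sum_(y <- locs m) \sum_(z <- slide_flips y) G z <= 6%:R * total.
Proof.
move=> nm; pose phi k y := nth y (slide_flips y) k.
have -> : \sum_(y <- locs m) \sum_(z <- slide_flips y) G z =
    \sum_(k <- iota 0 6) \sum_(y <- locs m) G (phi k y).
  rewrite exchange_big /=; apply: eq_big_seq => -[K x].
  rewrite mem_locs => /andP[]; case: x => // a b c _ _.
  by rewrite /slide_flips /phi /= !big_cons !big_nil.
have bnd k : (k < 6)%N -> \sum_(y <- locs m) G (phi k y) <= total.
  move=> hk; apply: sum_map_le => //; try exact: uniq_locs.
    move=> [K x]; rewrite mem_locs => /andP[]; case: x => // a b c _.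
    rewrite sz_plug /= => /eqP em.
    by case: k hk => [|[|[|[|[|[|?]]]]]] //= _; rewrite mem_locs sz_plug /=;
       apply/eqP; lia.
  move=> [K1 x1] [K2 x2]; rewrite !mem_locs => /andP[+ _] /andP[+ _].
  case: x1 x2 => // a1 b1 c1 [] // a2 b2 c2 _ _.
  by case: k hk => [|[|[|[|[|[|?]]]]]] //= _ [] *; subst.
rewrite /= !big_cons big_nil.
have := bnd 0%N isT; have := bnd 1%N isT; have := bnd 2%N isT.
by have := bnd 3%N isT; have := bnd 4%N isT; have := bnd 5%N isT; lra.
Qed.

Definition at_shift (T : Type) (f : ctx -> tern -> tern -> tern -> tern -> seq T)
    (z : loc) : seq T :=
  if z.2 is N (N a b c) L d then f z.1 a b c d else [::].

Lemma at_shift_sum (t : seq loc) f (c : loc -> nat) k (H : loc -> R) :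
  uniq t -> (forall z, 0 <= H z) -> (forall K a b e d, uniq (f K a b e d)) ->
  (forall K a b e d j, (csz K + sz a + sz b + sz e + sz d + 2)%N = n ->
     j \in f K a b e d -> j \in t /\ (c (K, N (N a b e) L d) < k)%N) ->
  (forall K a b e d K' a' b' e' d' j,
     j \in f K a b e d -> j \in f K' a' b' e' d' ->
     c (K, N (N a b e) L d) = c (K', N (N a' b' e') L d') ->
     (K, N (N a b e) L d) = (K', N (N a' b' e') L d')) ->
  \sum_(z <- locs n) \sum_(j <- at_shift f z) H j <= k%:R * \sum_(j <- t) H j.
Proof.
move=> ut H0 uf tf inj; apply: (sum_sub_le (c := c)) => //.
- exact: uniq_locs.
- by case=> K [//|[//|a b e] [|//] d] _; apply: uf.
- case=> K [//|[//|a b e] [|//] d] j; rewrite mem_locs sz_plug /= => /eqP en.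
  by move=> jf; apply: tf jf => /=; lia.
- case=> K1 [//|[//|a1 b1 e1] [|//] d1] [K2 [//|[//|a2 b2 e2] [|//] d2]] j _ _.
  exact: inj.
Qed.

Lemma sum_slide K x : \sum_(z <- slide_route K x) G z =
  \sum_(y <- nodes K x) \sum_(z <- slide_flips y) G z.
Proof. by rewrite /slide_route big_flatten /= big_map. Qed.

Let slideG y := \sum_(z <- slide_flips y) G z.

Lemma slideG_ge0 y : 0 <= slideG y. Proof. exact: sumr_ge0. Qed.

Let szc (z : loc) := if z.2 is N (N a b c) _ d then sz c else 0%N.

Lemma mem_nodes_locs m K x j : (csz K + sz x)%N = m ->
  j \in nodes K x -> j \in locs m.
Proof.
move=> em; case: j => K' y /mem_nodes[st -> [ex yL]].
by rewrite mem_locs yL plug_cat ex sz_plug em eqxx.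
Qed.

Lemma csz_sz st y x : plug st y = x -> (csz st + sz y)%N = sz x.
Proof. by move=> <-; rewrite sz_plug. Qed.

(** The sliding subtree [c] has a size that grows with the level, so its size
    encodes the starting level. *)
Lemma shift_nodes_c (m : nat) : n = m.+1 ->
  \sum_(z <- locs n) \sum_(j <- at_shift (fun K a b c d => nodes (spine b ++ FB a d :: K) c) z) slideG j
    <= n%:R * \sum_(y <- locs m) slideG y.
Proof.
move=> nm; have um := uniq_locs m; have g0 := slideG_ge0.
  apply: (at_shift_sum (c := szc)) => //; rewrite /szc.
  - by move=> K a b c d; apply: uniq_nodes.
  - move=> K a b c d j en jn; split=> /=; last by lia.
    by apply: mem_nodes_locs jn; rewrite csz_spine /=; lia.
  move=> K a b c d K' a' b' c' d' [K2 y] /mem_nodes[st -> [e1 _]].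
  case/mem_nodes => st' /= eK [e2 _] ec.
  have cst : csz st = csz st'.
    by have := csz_sz e1; have := csz_sz e2; lia.
  have [est eK'] := ctx_split eK cst.
  have := congr1 strip eK'; rewrite !strip_spine // => -[-> -> -> ->].
  by rewrite -e1 -e2 est.
Qed.

(** Here the cut between [c] and [d] is lost as well; [sz b + sz c] encodes both the
    level and the cut. *)
Lemma shift_nodes_b (m : nat) : n = m.+1 ->
  \sum_(z <- locs n) \sum_(j <- at_shift (fun K a b c d => nodes (FB a (tcat c d) :: K) b) z) slideG j
    <= n%:R * \sum_(y <- locs m) slideG y.
Proof.
move=> nm; have um := uniq_locs m; have g0 := slideG_ge0.
  apply: (at_shift_sum (c := fun z => if z.2 is N (N a b c) _ d then
    (sz b + sz c)%N else 0%N)) => //.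
  - by move=> K a b c d; apply: uniq_nodes.
  - move=> K a b c d j en jn; split=> /=; last by lia.
    by apply: mem_nodes_locs jn; rewrite /= sz_tcat; lia.
  move=> K a b c d K' a' b' c' d' [K2 y] /mem_nodes[st -> [e1 _]].
  case/mem_nodes => st' /= eK [e2 _] ec.
  have := csz_sz e1; have := csz_sz e2 => es2 es1.
  have [|||est [-> eT] -> /(tcat_inj eT)[-> ->]] := @level_split _ _ _ _ _ _ (sz c) (sz c') eK.
  - by lia.
  - by rewrite /= sz_tcat; lia.
  - by rewrite /= sz_tcat; lia.
  by rewrite -e1 -e2 est.
Qed.

Lemma shift_nodes_a (m : nat) : n = m.+1 ->
  \sum_(z <- locs n) \sum_(j <- at_shift (fun K a b c d => nodes (FA b (tcat c d) :: K) a) z) slideG j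
    <= n%:R * \sum_(y <- locs m) slideG y.
Proof.
move=> nm; have um := uniq_locs m; have g0 := slideG_ge0.
  apply: (at_shift_sum (c := fun z => if z.2 is N (N a b c) _ d then
    (sz a + sz c)%N else 0%N)) => //.
  - by move=> K a b c d; apply: uniq_nodes.
  - move=> K a b c d j en jn; split=> /=; last by lia.
    by apply: mem_nodes_locs jn; rewrite /= sz_tcat; lia.
  move=> K a b c d K' a' b' c' d' [K2 y] /mem_nodes[st -> [e1 _]].
  case/mem_nodes => st' /= eK [e2 _] ec.
  have := csz_sz e1; have := csz_sz e2 => es2 es1.
  have [|||est [-> eT] -> /(tcat_inj eT)[-> ->]] := @level_split _ _ _ _ _ _ (sz c) (sz c') eK.
  - by lia.
  - by rewrite /= sz_tcat; lia.
  - by rewrite /= sz_tcat; lia.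
  by rewrite -e1 -e2 est.
Qed.

(** Four of the single flips determine the shift, two of them lose the cut of
    [tcat c d] and count [n] times, and the three slides count [6 n] times each;
    the bound is [4 + 2 n + 18 n <= 24 n]. *)
Lemma sum_shift (m : nat) : n = m.+1 ->
  \sum_(y <- locs n) \sum_(z <- shift_route y) G z <= (24 * n)%:R * total.
Proof.
move=> nm.
have ul := uniq_locs; have g0 := slideG_ge0; have um := uniq_locs m.
pose f1 K a b c d := [:: (FA L d :: K, N a b c)] : seq loc.
pose f2 K a b c d := nodes (spine b ++ FB a d :: K) c.
pose f3 K a b c d := [:: (FB a d :: K, N b L c)] : seq loc.
pose f4 K a b c d := [:: (K, N a (N b L c) d)] : seq loc.
pose f5 K a b c d := nodes (FB a (tcat c d) :: K) b.
pose f6 K a b c d := [:: (FB a (tcat c d) :: K, N L b L)] : seq loc.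
pose f7 K a b c d := nodes (FA b (tcat c d) :: K) a.
pose f8 K a b c d := [:: (FA b (tcat c d) :: K, N L a L)] : seq loc.
pose f9 K a b c d := [:: (K, N L (N a b c) d)] : seq loc.
have single (f : ctx -> tern -> tern -> tern -> tern -> seq loc) (c : loc -> nat) (k : nat) :
    (forall K a b e d, exists z : loc, f K a b e d = [:: z]) ->
    (forall K a b e d, (csz K + sz a + sz b + sz e + sz d + 2)%N = n ->
     {subset f K a b e d <= locs n} /\ (c (K, N (N a b e) L d) < k)%N) ->
    (forall K a b e d K' a' b' e' d', f K a b e d = f K' a' b' e' d' ->
     c (K, N (N a b e) L d) = c (K', N (N a' b' e') L d') ->
     (K, N (N a b e) L d) = (K', N (N a' b' e') L d')) ->
    \sum_(z <- locs n) \sum_(j <- at_shift f z) G j <= k%:R * total.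
  move=> h1 h2 h3; apply: (at_shift_sum (c := c)) => //.
  - by move=> K a b e d; have [z ->] := h1 K a b e d.
  - by move=> K a b e d j /h2[sf ?] /sf.
  - move=> K a b e d K' a' b' e' d' j.
    have [z ez] := h1 K a b e d; have [z' ez'] := h1 K' a' b' e' d'.
    rewrite ez ez' !inE => /eqP-> /eqP e1; apply: h3.
    by rewrite ez ez' e1.
have inL z : z.2 != L -> (csz z.1 + sz z.2)%N = n -> {subset [:: z] <= locs n}.
  by move=> zL en y; rewrite inE => /eqP ->;
     case: z zL en => K x /= xL en; rewrite mem_locs xL sz_plug en eqxx.
have b1 : \sum_(z <- locs n) \sum_(j <- at_shift f1 z) G j <= 1%:R * total.
  apply: (single _ (fun=> 0%N)); rewrite /f1; first by eauto.
    by move=> K a b c d en; split=> //; apply: inL => //=; lia.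
  by move=> K a b e d K' a' b' e' d' [-> -> -> -> ->].
have b3 : \sum_(z <- locs n) \sum_(j <- at_shift f3 z) G j <= 1%:R * total.
  apply: (single _ (fun=> 0%N)); rewrite /f3; first by eauto.
    by move=> K a b c d en; split=> //; apply: inL => //=; lia.
  by move=> K a b e d K' a' b' e' d' [-> -> -> -> ->].
have b4 : \sum_(z <- locs n) \sum_(j <- at_shift f4 z) G j <= 1%:R * total.
  apply: (single _ (fun=> 0%N)); rewrite /f4; first by eauto.
    by move=> K a b c d en; split=> //; apply: inL => //=; lia.
  by move=> K a b e d K' a' b' e' d' [-> -> -> -> ->].
have b9 : \sum_(z <- locs n) \sum_(j <- at_shift f9 z) G j <= 1%:R * total.
  apply: (single _ (fun=> 0%N)); rewrite /f9; first by eauto.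
    by move=> K a b c d en; split=> //; apply: inL => //=; lia.
  by move=> K a b e d K' a' b' e' d' [-> -> -> -> ->].
have b6 : \sum_(z <- locs n) \sum_(j <- at_shift f6 z) G j <= n%:R * total.
  apply: (single _ szc); rewrite /f6 /szc; first by eauto.
    move=> K a b c d en; split=> /=; last by lia.
    by apply: inL => //=; rewrite sz_tcat; lia.
  by move=> K a b e d K' a' b' e' d' /= [-> /tcat_inj eT -> ->] /eT[-> ->].
have b8 : \sum_(z <- locs n) \sum_(j <- at_shift f8 z) G j <= n%:R * total.
  apply: (single _ szc); rewrite /f8 /szc; first by eauto.
    move=> K a b c d en; split=> /=; last by lia.
    by apply: inL => //=; rewrite sz_tcat; lia.
  by move=> K a b e d K' a' b' e' d' /= [-> /tcat_inj eT -> ->] /eT[-> ->].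
have -> : \sum_(y <- locs n) \sum_(z <- shift_route y) G z =
  \sum_(z <- locs n) \sum_(j <- at_shift f1 z) G j +
  \sum_(z <- locs n) \sum_(j <- at_shift f2 z) slideG j +
  \sum_(z <- locs n) \sum_(j <- at_shift f3 z) G j +
  \sum_(z <- locs n) \sum_(j <- at_shift f4 z) G j +
  \sum_(z <- locs n) \sum_(j <- at_shift f5 z) slideG j +
  \sum_(z <- locs n) \sum_(j <- at_shift f6 z) G j +
  \sum_(z <- locs n) \sum_(j <- at_shift f7 z) slideG j +
  \sum_(z <- locs n) \sum_(j <- at_shift f8 z) G j +
  \sum_(z <- locs n) \sum_(j <- at_shift f9 z) G j.
  rewrite -!big_split /=; apply: eq_bigr => -[K x] _.
  rewrite /at_shift /shift_route /=.
  case: x => [|[|a b c] [|? ? ?] d]; rewrite ?big_nil ?addr0 //.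
  by rewrite !(big_cons, big_cat, sum_slide, big_nil) /= !addr0 -!addrA.
have b2 := shift_nodes_c nm; have b5 := shift_nodes_b nm.
have b7 := shift_nodes_a nm; rewrite -/f2 -/f5 -/f7 in b2 b5 b7.
have hM := sum_slide_flips nm; rewrite -/slideG in hM.
have t0 := total_ge0; have n1 : 1 <= n%:R :> R by rewrite nm ler1n.
have hM' : n%:R * (\sum_(y <- locs m) slideG y) <= n%:R * (6%:R * total).
  by rewrite ler_wpM2l.
have nt : total <= n%:R * total by rewrite ler_peMl.
rewrite mulrCA in hM'; rewrite natrM -mulrA.
move: b1 b2 b3 b4 b5 b6 b7 b8 b9 hM' nt; rewrite !mul1r.
move: (n%:R * total) (n%:R * _) => NT NM.
lra.
Qed.

Definition at_am (T : Type) (f g : ctx -> tern -> tern -> tern -> tern -> tern -> seq T)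
    (z : loc) : seq T :=
  if z is (K, N a L c) then
    match strip K with
    | (q, FA x y :: K0) => f K0 q a c x y
    | (q, FB x y :: K0) => g K0 q a c x y
    | _ => [::]
    end
  else [::].

Lemma at_amP (T : eqType) f g z (j : T) : j \in at_am f g z ->
  exists K0 q a c x y,
    (z = (spine q ++ FA x y :: K0, N a L c) /\ j \in f K0 q a c x y) \/
    (z = (spine q ++ FB x y :: K0, N a L c) /\ j \in g K0 q a c x y).
Proof.
case: z => K [//|a [|//] c] /=; have := strip_cat K.
case: (strip K) => q [//|[x y|x y|//] K0] /= <- hj; exists K0, q, a, c, x, y.
- by left.
- by right.
Qed.

Lemma at_am_single (f g : ctx -> tern -> tern -> tern -> tern -> tern -> seq loc)
    (c : loc -> nat) k (H : loc -> R) :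
  (forall z, 0 <= H z) ->
  (forall z, z \in locs n -> (size (at_am f g z) <= 1)%N) ->
  (forall K q a b x y j, j \in f K q a b x y -> 
     (csz K + sz q + sz a + sz b + sz x + sz y + 2)%N = n ->
     j \in locs n /\ (c (spine q ++ FA x y :: K, N a L b) < k)%N) ->
  (forall K q a b x y j, j \in g K q a b x y -> 
     (csz K + sz q + sz a + sz b + sz x + sz y + 2)%N = n ->
     j \in locs n /\ (c (spine q ++ FB x y :: K, N a L b) < k)%N) ->
  (forall z1 z2 j, j \in at_am f g z1 -> j \in at_am f g z2 -> c z1 = c z2 -> z1 = z2) ->
  \sum_(z <- locs n) \sum_(j <- at_am f g z) H j <= k%:R * \sum_(z <- locs n) H z.
Proof.
move=> H0 sz1 hf hg inj; apply: (sum_sub_le (c := c)) => //.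
- exact: uniq_locs.
- exact: uniq_locs.
- by move=> z /sz1; case: (at_am f g z) => [|? []].
- move=> z j zl /at_amP[K [q [a [b [x [y [] [ez hj]]]]]]]; subst z.
    by apply: hf hj _; move: zl; rewrite mem_locs sz_plug csz_spine /= => /eqP; lia.
  by apply: hg hj _; move: zl; rewrite mem_locs sz_plug csz_spine /= => /eqP; lia.
by move=> z1 z2 j _ _; apply: inj.
Qed.

(** Every shift is used at most twice, three single flips determine the peak, and
    one flip forgets where the spine [q] ends and counts [n] times; the bound is
    [48 n + n + 3 <= 52 n]. *)
Lemma sum_am (m : nat) : n = m.+1 ->
  \sum_(y <- locs n) \sum_(z <- am_route y) G z <= (52 * n)%:R * total.
Proof.
move=> nm.
pose nil6 (_ : ctx) (_ _ _ _ _ : tern) : seq loc := [::].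
pose f1 K q a c x y := [:: (spine q ++ FA x y :: K, N a L c)] : seq loc.
pose f2 K q a c x y := [:: (K, N (tcat q (N L a c)) x y)] : seq loc.
pose f3 K q a c x y := [:: (K, N q a (N c x y))] : seq loc.
pose g4 K q a c x y := [:: (spine q ++ FB x y :: K, N a L c)] : seq loc.
pose g5 K q a c x y := [:: (spine x ++ FA c y :: K, N q L a)] : seq loc.
pose S z := \sum_(j <- shift_route z) G j.
have S0 z : 0 <= S z by exact: sumr_ge0.
have -> : \sum_(y <- locs n) \sum_(z <- am_route y) G z =
  \sum_(z <- locs n) \sum_(j <- at_am f1 nil6 z) S j +
  \sum_(z <- locs n) \sum_(j <- at_am f2 nil6 z) G j +
  \sum_(z <- locs n) \sum_(j <- at_am f3 nil6 z) G j +
  \sum_(z <- locs n) \sum_(j <- at_am nil6 g4 z) G j +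
  \sum_(z <- locs n) \sum_(j <- at_am nil6 g5 z) S j +
  \sum_(z <- locs n) \sum_(j <- at_am nil6 g5 z) G j.
  rewrite -!big_split /=; apply: eq_bigr => -[K x] _.
  rewrite /am_route /at_am.
  case: x => [|a [|? ? ?] c]; rewrite ?big_nil ?addr0 //.
  have := strip_cat K; case: (strip K) => q [|[x y|x y|x y] K0] /= eK;
    rewrite ?big_nil ?addr0 //.
  - by rewrite big_cat /= /f1 /f2 /f3 !(big_cons, big_nil) !addr0 /S eK addrA.
  - rewrite big_cons big_cat /= /g4 /g5 !(big_cons, big_nil) !addr0 !add0r eK.
    by rewrite -addrA.
have size1 f g : (forall K q a c x y, (size (f K q a c x y : seq loc) <= 1)%N) ->
   (forall K q a c x y, (size (g K q a c x y : seq loc) <= 1)%N) ->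
   forall z, z \in locs n -> (size (at_am f g z) <= 1)%N.
  move=> hf hg [K [|a [|? ? ?] c]] _ //=.
  by case: (strip K) => q [|[x y|x y|x y] K0] /=.
have decA (K1 K2 : ctx) q1 q2 x1 x2 y1 y2 : spine q1 ++ FA x1 y1 :: K1 = spine q2 ++ FA x2 y2 :: K2 ->
   [/\ q1 = q2, x1 = x2, y1 = y2 & K1 = K2].
  by move=> /(congr1 strip); rewrite !strip_spine // => -[-> -> -> ->].
pose szq (z : loc) := sz (strip z.1).1.
have c1 : \sum_(z <- locs n) \sum_(j <- at_am f1 nil6 z) S j <=
    1%:R * \sum_(z <- locs n) S z.
  apply: (at_am_single (c := fun=> 0%N)) => //; first by apply: size1.
    move=> K q a c x y j; rewrite inE => /eqP-> en; split=> //.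
    by rewrite mem_locs sz_plug csz_spine /=; apply/eqP; lia.
  move=> z1 z2 j /at_amP[K [q [a [c [x [y [[-> +]|[_ //]]]]]]]].
  rewrite inE => /eqP->.
  move=> /at_amP[K2 [q2 [a2 [c2 [x2 [y2 [[-> +]|[_ //]]]]]]]].
  by rewrite inE => /eqP->.
have c4 : \sum_(z <- locs n) \sum_(j <- at_am nil6 g4 z) G j <= 1%:R * total.
  apply: (at_am_single (c := fun=> 0%N)) => //; first by apply: size1.
    move=> K q a c x y j; rewrite inE => /eqP-> en; split=> //.
    by rewrite mem_locs sz_plug csz_spine /=; apply/eqP; lia.
  move=> z1 z2 j /at_amP[K [q [a [c [x [y [[_ //]|[-> +]]]]]]]].
  rewrite inE => /eqP->.
  move=> /at_amP[K2 [q2 [a2 [c2 [x2 [y2 [[_ //]|[-> +]]]]]]]].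
  by rewrite inE => /eqP->.
have c3 : \sum_(z <- locs n) \sum_(j <- at_am f3 nil6 z) G j <= 1%:R * total.
  apply: (at_am_single (c := fun=> 0%N)) => //; first by apply: size1.
    move=> K q a c x y j; rewrite inE => /eqP-> en; split=> //.
    by rewrite mem_locs sz_plug /=; apply/eqP; lia.
  move=> z1 z2 j /at_amP[K [q [a [c [x [y [[-> +]|[_ //]]]]]]]].
  rewrite inE => /eqP->.
  move=> /at_amP[K2 [q2 [a2 [c2 [x2 [y2 [[-> +]|[_ //]]]]]]]].
  by rewrite inE => /eqP[-> -> -> -> -> ->].
(* the end of the spine is lost, and its size restores it *)
have c2 : \sum_(z <- locs n) \sum_(j <- at_am f2 nil6 z) G j <= n%:R * total.
  apply: (at_am_single (c := szq)) => //; first by apply: size1.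
    move=> K q a c x y j; rewrite inE => /eqP-> en; split.
      by rewrite mem_locs sz_plug /= sz_tcat /=; apply/eqP; lia.
    by rewrite /szq /= strip_spine //=; lia.
  move=> z1 z2 j /at_amP[K [q [a [c [x [y [[-> +]|[_ //]]]]]]]].
  rewrite inE => /eqP->.
  move=> /at_amP[K2 [q2 [a2 [c2 [x2 [y2 [[-> +]|[_ //]]]]]]]].
  rewrite inE /szq /= !strip_spine //= => /eqP[-> /tcat_inj eT -> ->].
  by move=> /eT[-> [-> ->]].
have c5 (H : loc -> R) : (forall z, 0 <= H z) ->
   \sum_(z <- locs n) \sum_(j <- at_am nil6 g5 z) H j <= 1%:R * \sum_(z <- locs n) H z.
  move=> H0.
  apply: (at_am_single (c := fun=> 0%N)) => //; first by apply: size1.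
    move=> K q a c x y j; rewrite inE => /eqP-> en; split=> //.
    by rewrite mem_locs sz_plug csz_spine /=; apply/eqP; lia.
  move=> z1 z2 j /at_amP[K [q [a [c [x [y [[_ //]|[-> +]]]]]]]].
  rewrite inE => /eqP->.
  move=> /at_amP[K2 [q2 [a2 [c2' [x2 [y2 [[_ //]|[-> +]]]]]]]].
  by rewrite inE => /eqP[/decA[-> -> -> ->] -> ->].
have hS := sum_shift nm; rewrite -/S in hS.
have c5S := c5 _ S0; have c5G := c5 _ G0.
have t0 := total_ge0; have n1 : 1 <= n%:R :> R by rewrite nm ler1n.
have nt : total <= n%:R * total by rewrite ler_peMl.
move: c1 c2 c3 c4 c5S c5G hS nt; rewrite !natrM !mul1r -!mulrA.
by move: (n%:R * total) => NT; clear; lra.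
Qed.

End Counting.

(** * From ternary trees to non-crossing spanning trees *)

Definition tree_set (n : nat) (x : tern) : {set edge n} :=
  [set e | (val e.1, val e.2) \in arcs 0 x].

(** Connectedness in the form of an induction principle: a property that every edge
    preserves holds everywhere or nowhere. *)
Lemma arcs_connected o x (P : nat -> Prop) :
  (forall i j, (i, j) \in arcs o x -> (P i <-> P j)) ->
  forall k, o <= k <= o + sz x -> (P k <-> P o).
Proof.
elim: x o => [|a IHa b IHb c IHc] o /= hP k hk; first by have -> : k = o by lia.
have ha : forall k, o <= k <= o + sz a -> (P k <-> P o).
  by apply: IHa => i j h; apply: hP; rewrite inE !mem_cat h !orbT.
have hb : forall k, o + sz a + 1 <= k <= o + sz a + 1 + sz b -> (P k <-> P (o + sz a + 1)).
  by apply: IHb => i j h; apply: hP; rewrite inE !mem_cat h !orbT.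
have hc : forall k, o + sz a + 1 + sz b <= k <= o + sz a + 1 + sz b + sz c ->
    (P k <-> P (o + sz a + 1 + sz b)).
  by apply: IHc => i j h; apply: hP; rewrite inE !mem_cat h !orbT.
have hr : P o <-> P (o + sz a + 1 + sz b) by apply: hP; rewrite inE eqxx.
case: (leqP k (o + sz a)) => h1; first by apply: ha; lia.
have ht : P (o + sz a + 1) <-> P o.
  by rewrite hr; symmetry; apply: hb; lia.
case: (leqP k (o + sz a + 1 + sz b)) => h2.
  by rewrite -ht; apply: hb; lia.
by rewrite hr; apply: hc; lia.
Qed.

Lemma arcs_noncrossing o x i j k l :
  (i, j) \in arcs o x -> (k, l) \in arcs o x -> i < k -> k < j -> j < l -> False.
Proof.
elim: x o => [//|a IHa b IHb c IHc] o /=; rewrite !inE !mem_cat.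
move=> /or4P[/eqP[-> ->]|h1|h1|h1] /or4P[/eqP[-> ->]|h2|h2|h2];
  try (by apply: IHa h1 h2); try (by apply: IHb h1 h2); try (by apply: IHc h1 h2);
  try (have := arcs_range h1); try (have := arcs_range h2); lia.
Qed.

(** Every edge is a bridge.  The two sides of the root edge are separated by a
    threshold; a colouring for an edge of a part extends by a constant, because a
    part touches the other ones at a single vertex. *)
Lemma arcs_cut o x e : e \in arcs o x -> exists col : nat -> bool,
  col e.1 != col e.2 /\
  {in arcs o x, forall e', e' != e -> col e'.1 = col e'.2}.
Proof.
elim: x o e => [//|a IHa b IHb c IHc] o e /=; rewrite inE !mem_cat.
set s := o + sz a; set t := s + 1 + sz b.
have hr k l : (k, l) \in arcs o (N a b c) -> [\/ k = o /\ l = t,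
   o <= k < l /\ l <= s /\ (k, l) \in arcs o a,
   s < k < l /\ l <= t /\ (k, l) \in arcs (s + 1) b |
   t <= k < l /\ (k, l) \in arcs t c].
  rewrite inE !mem_cat => /or4P[/eqP[-> ->]|h|h|h]; first by apply: Or41.
  - by have := arcs_range h; rewrite -/s => r; apply: Or42; rewrite h; do ?split; lia.
  - by have := arcs_range h; rewrite -/s -/t => r; apply: Or43; rewrite h; do ?split; lia.
  - by have := arcs_range h; rewrite -/s -/t => r; apply: Or44; rewrite h; do ?split; lia.
case: e => i j /or4P[/eqP[-> ->]|h|h|h].
- exists (fun v => v <= s) => /=; split; first by rewrite /t /s; lia.
  case=> k l /hr[[-> ->]|[? [? _]]|[? [? _]]|[? _]] /=; rewrite ?eqxx //; rewrite /t; lia.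
- have [col [h1 h2]] := IHa _ _ h; have := arcs_range h; rewrite -/s => rh.
  exists (fun v => if v <= s then col v else col o) => /=; split.
    by rewrite !ifT; [exact: h1|lia|lia].
  case=> k l /hr[[-> ->]|[? [? hkl]]|[? [? _]]|[? _]] ne /=.
  + by case: ifP; case: ifP => //; rewrite /t; lia.
  + by rewrite !ifT; [exact: h2 hkl ne|lia|lia].
  + by rewrite !ifF //; lia.
  + by rewrite !ifF //; rewrite /t; lia.
- have [col [h1 h2]] := IHb _ _ h; have := arcs_range h; rewrite -/s -/t => rh.
  exists (fun v => if s < v <= t then col v else col t) => /=; split.
    by rewrite !ifT; [exact: h1|lia|lia].
  case=> k l /hr[[-> ->]|[? [? _]]|[? [? hkl]]|[? _]] ne /=.
  + by rewrite if_same ifF //; rewrite /s; lia.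
  + by rewrite !ifF //; lia.
  + by rewrite !ifT; [exact: h2 hkl ne|lia|lia].
  + have -> : (s < l <= t) = false by lia.
    by case: ifP => // hk; congr col; lia.
- have [col [h1 h2]] := IHc _ _ h; have := arcs_range h; rewrite -/s -/t => rh.
  exists (fun v => if t <= v then col v else col t) => /=; split.
    by rewrite !ifT; [exact: h1|lia|lia].
  case=> k l /hr[[-> ->]|[? [? _]]|[? [? _]]|[? hkl]] ne /=.
  + by rewrite leqnn ifF //; rewrite /t /s; lia.
  + by rewrite !ifF //; rewrite /t; lia.
  + case: (l =P t) => [->|?]; first by rewrite leqnn; case: ifP => // ?; congr col; lia.
    by rewrite !ifF //; lia.
  + by rewrite !ifT; [exact: h2 hkl ne|lia|lia].
Qed.

Lemma tree_set_connected n x (U : {set edge n}) : sz x = n ->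
  tree_set n x \subset U -> is_connected U.
Proof.
move=> en /subsetP sub.
have sU (u v : 'I_n.+1) : (u : nat, v : nat) \in arcs 0 x -> adj U u v.
  by move=> h; apply/orP; left; apply: sub; rewrite inE.
have cU u : connect (adj U) ord0 u.
  have -> : u = inord u by apply: val_inj; rewrite /= inordK.
  have h k : 0 <= k <= 0 + sz x -> connect (adj U) ord0 (inord k) <-> connect (adj U) ord0 (inord 0).
    move: k; apply: arcs_connected => i j hij.
    have := arcs_range hij => r.
    have aij : adj U (inord i) (inord j) by apply: sU; rewrite !inordK //; lia.
    split=> hc; apply: connect_trans hc _; apply: connect1 => //.
    by move: aij; rewrite /adj orbC.
  apply/(h u); first by rewrite en add0n leq0n -ltnS ltn_ord.
  by rewrite (_ : inord 0 = ord0) ?connect0 //; apply: val_inj; rewrite /= inordK.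
apply/forallP => u; apply/forallP => v; apply: connect_trans (cU v).
by rewrite (sym_connect_sym (fun v w => orbC _ _)).
Qed.

Section TreeSet.
Variables (n : nat) (x : tern).
Hypothesis en : sz x = n.
Local Notation T := (tree_set n x).

Lemma adj_arcs (u v : 'I_n.+1) : adj T u v ->
  ((u : nat, v : nat) \in arcs 0 x) || ((v : nat, u : nat) \in arcs 0 x).
Proof. by rewrite /adj !inE. Qed.

(** The colour cannot change on the way: the path leaves [v] through [w] and enters
    [u] from a vertex other than [v], so it avoids the edge between [u] and [v]. *)
Lemma cut_path (col : nat -> bool) (u v w : 'I_n.+1) p :
  (forall i j : 'I_n.+1, adj T i j -> (i, j) != (u, v) -> (i, j) != (v, u) -> col i = col j) ->
  path (adj T) v (rcons (w :: p) u) -> uniq (u :: v :: w :: p) -> col v = col u.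
Proof.
move=> hcol; rewrite rcons_path => /andP[hp hl].
rewrite /= inE negb_or => /and3P[/andP[uv up] vp _].
have step : forall q y, path (adj T) y q -> u \notin y :: q -> col y = col (last y q).
  elim=> //= z q IH y /andP[yz hq]; rewrite !inE !negb_or => /and3P[uy uz uq].
  rewrite -(IH z) ?inE ?negb_or ?uz //; apply: hcol => //.
    by apply: contra uy => /eqP[->].
  by apply: contra uz => /eqP[_ ->].
rewrite (step _ _ hp); last by rewrite inE negb_or uv.
apply: hcol => //; last by apply: contraNneq vp => -[<-]; apply: mem_last.
by apply: contra_neq uv => -[_].
Qed.

(** A cycle of length at least three would join the ends of its first edge while
    avoiding this edge, against [arcs_cut]. *)
Lemma tree_set_acyclic : is_acyclic T.
Proof.
apply/forallP => k; apply/forallP => -[p sp] /=; apply/implyP => /andP[].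
move: sp => /eqP <-; case: p => [|u [|v [|w p]]] //= /andP[auv hp] up.
exfalso; case/orP: (adj_arcs auv) => /arcs_cut[col [/= h1 h2]].
  have /= cv := @cut_path (fun i => col i) u v w p _ hp up.
  rewrite cv ?eqxx // in h1 => i j /adj_arcs /orP[] hij n1 n2.
    by apply: (h2 _ hij); apply: contra n1 => /eqP[/val_inj-> /val_inj->].
  by symmetry; apply: (h2 _ hij); apply: contra n2 => /eqP[/val_inj-> /val_inj->].
have /= cv := @cut_path (fun i => col i) u v w p _ hp up.
rewrite cv ?eqxx // in h1 => i j /adj_arcs /orP[] hij n1 n2.
  by apply: (h2 _ hij); apply: contra n2 => /eqP[/val_inj-> /val_inj->].
by symmetry; apply: (h2 _ hij); apply: contra n1 => /eqP[/val_inj-> /val_inj->].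
Qed.

Lemma tree_set_ncst : is_ncst T.
Proof.
apply/and4P; split.
- by apply/forall_inP => e; rewrite inE => /arcs_range /=; case/andP => /andP[].
- exact: tree_set_connected en _.
- exact: tree_set_acyclic.
- apply/forall_inP => e; rewrite inE => he; apply/forall_inP => e'; rewrite inE => he'.
  by apply/negP => /and3P[]; apply: arcs_noncrossing he he'.
Qed.

End TreeSet.

Lemma arcs_shift o d x i j :
  ((o + i, o + j) \in arcs (o + d) x) = ((i, j) \in arcs d x).
Proof.
elim: x d => [//|a IHa b IHb c IHc] d /=; rewrite !inE !mem_cat -!addnA -IHa.
rewrite -(IHb (d + (sz a + 1))) -(IHc (d + (sz a + (1 + sz b)))).
by rewrite !xpair_eqE !eqn_add2l.
Qed.

Lemma segment_tree_set n m d x y :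
  d + m <= n -> (forall i j, i <= m -> j <= m -> 
     ((d + i, d + j) \in arcs 0 x) = ((i, j) \in arcs 0 y)) ->
  segment (tree_set n x) d m = tree_set m y.
Proof.
move=> dm h; apply/setP => -[i j]; rewrite !inE /=.
have := ltn_ord i; have := ltn_ord j => hj hi.
by rewrite !inordK ?h //; lia.
Qed.

Lemma arcs_N o a b c : arcs o (N a b c) =
  (o, o + sz a + 1 + sz b) :: arcs o a ++ arcs (o + sz a + 1) b
    ++ arcs (o + sz a + 1 + sz b) c.
Proof. by []. Qed.

Local Arguments arcs : simpl never.

Lemma tree_set_path m x : sz x = m -> tree_path (tree_set m x) (word x).
Proof.
elim: x m => [|a IHa b IHb c IHc] m /= em.
  by apply: TreePathEmpty => //; apply/setP => e; rewrite !inE.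
set s : 'I_m.+1 := inord (sz a); set t : 'I_m.+1 := inord (sz a + 1 + sz b).
have es : s = sz a :> nat by rewrite inordK //; lia.
have et : t = sz a + 1 + sz b :> nat by rewrite inordK //; lia.
have memN i j : (i, j) \in arcs 0 (N a b c) -> [\/ i = 0 /\ j = t,
   i < j <= s /\ (i, j) \in arcs 0 a,
   (s < i < j) && (j <= t) /\ (i, j) \in arcs s.+1 b |
   t <= i < j /\ (i, j) \in arcs t c].
  rewrite arcs_N inE !mem_cat -(addn1 s) es et !add0n => /or4P[/eqP[-> ->]|h|h|h].
  - by apply: Or41.
  - by have := arcs_range h => r; apply: Or42; rewrite h; split=> //; lia.
  - by have := arcs_range h => r; apply: Or43; rewrite h; split=> //; lia.
  - by have := arcs_range h => r; apply: Or44; rewrite h; split=> //; lia.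
have inN i j : [|| (i, j) == (0, t : nat), (i, j) \in arcs 0 a,
    (i, j) \in arcs s.+1 b | (i, j) \in arcs t c] -> (i, j) \in arcs 0 (N a b c).
  by rewrite arcs_N inE !mem_cat -(addn1 s) es et !add0n.
apply: (TreePathNode (s := s) (t := t)).
- split.
  + by rewrite inE inN //= eqxx.
  + move=> u; rewrite inE /= => /memN[[_ ->]|[? _]|[? _]|[? _]] //; lia.
  + apply: (tree_set_connected (x := a)) => //; apply/subsetP => -[i j].
    rewrite in_set /= => h; have r := arcs_range h.
    rewrite in_set in_setD1 in_set /= !add0n; apply/andP; split.
      by apply/eqP => -[_ /(congr1 val) /=]; rewrite !inordK //; lia.
    by rewrite !inordK; [apply: inN; rewrite h orbT|lia|lia].
  + move=> k /andP[sk km]; apply/negP => /forallP /(_ ord0) /forallP /(_ (inord s.+1)).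
    set U := segment _ _ _ => hc.
    have cl : closed (adj U) [pred v : 'I_k.+1 | v <= s].
      have hU (u v : 'I_k.+1) : (u, v) \in U -> (u <= s) = (v <= s).
        rewrite in_set in_setD1 in_set /= !add0n => /andP[ne].
        have := ltn_ord u; have := ltn_ord v => hv hu.
        rewrite !inordK; try lia.
        case/memN => [[eu ev]|[? _]|[? _]|[? _]]; try lia.
        case/negP: ne; apply/eqP; congr (_, _); apply: val_inj => /=.
          by rewrite inordK //; lia.
        by rewrite inordK //; lia.
      by move=> u v; rewrite !inE => /orP[/hU|/hU].
    by have := closed_connect cl hc; rewrite !inE /= inordK // ltnn.
- rewrite (@segment_tree_set m s 0 _ a); [|lia|]; first exact: IHa.
  move=> i j hi hj; rewrite !add0n; apply/idP/idP => [|h]; last by apply: inN; rewrite h orbT.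
  by move=> hm; case: (memN _ _ hm) => [[? ?]|[_ ->]|[? _]|[? _]] //; lia.
- rewrite (@segment_tree_set m (t - s.+1) s.+1 _ b); [|lia|].
    by apply: IHb; lia.
  move=> i j hi hj; rewrite -(arcs_shift s.+1 0 b) addn0; apply/idP/idP => [|h].
    by move=> hm; case: (memN _ _ hm) => [[? ?]|[? _]|[_ ->]|[? _]] //; lia.
  by apply: inN; rewrite h !orbT.
- rewrite (@segment_tree_set m (m - t) t _ c); [|lia|].
    by apply: IHc; lia.
  move=> i j hi hj; rewrite -(arcs_shift t 0 c) addn0; apply/idP/idP => [|h].
    by move=> hm; case: (memN _ _ hm) => [[? ?]|[? _]|[? _]|[_ ->]] //; lia.
  by apply: inN; rewrite h !orbT.
Qed.

(** * From non-crossing spanning trees to ternary trees *)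

Section NoncrossingTrees.
Variable E : rel nat.
Hypothesis Esym : forall i j, E i j -> E j i.
Hypothesis Enc : forall i j k l, i < k -> k < j -> j < l -> E i j -> E k l -> False.
Hypothesis Eac : forall p, ucycle E p -> size p <= 2.

(** Connectedness by closed properties avoids choosing paths, and makes it easy to
    pass to subintervals. *)
Definition closed_on (a b : nat) (P : nat -> Prop) :=
  forall i j, a <= i <= b -> a <= j <= b -> E i j -> P i -> P j.

Definition connected_on (a b : nat) :=
  forall P, closed_on a b P -> forall i j, a <= i <= b -> a <= j <= b -> P i -> P j.

Lemma connected_root a b r : a <= r <= b ->
  (forall P, closed_on a b P -> P r -> forall i, a <= i <= b -> P i) ->
  connected_on a b.
Proof.
move=> hr h P cl i j hi hj Pi; apply: (h P) => //.
have cl' : closed_on a b (fun k => ~ P k).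
  by move=> k l hk hl /Esym ekl nk /(cl _ _ hl hk ekl).
by apply: contrapT => nPr; apply: (h _ cl' nPr i).
Qed.

(** Let [t] be the last neighbour of the first vertex [a].  Without the edge from
    [a] to [t], the component [X] of [a] does not contain [t], by acyclicity, and
    it stays below [t], by the choice of [t] and the absence of crossings.  It is
    an interval: an edge of [X] above a vertex outside [X] would be crossed on the
    way from that vertex to [t].  No edge passes over [t] in the component [Y] of
    [t], so [Y] splits at [t] into two connected intervals. *)
Lemma noncrossing_tree k a : connected_on a (a + k) ->
  exists x, sz x = k /\ forall i j, a <= i -> i < j -> j <= a + k ->
    (E i j <-> (i, j) \in arcs a x).
Proof.
elim/ltn_ind: k a => k IH a conn.
have [->|k0] := posnP k.
  by exists L; split=> // i j; lia.
set b := a + k.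
have [u0 hu0] : exists u, (a < u <= b) && E a u.
  apply: contrapT => nu; pose P i := i = a.
  have cl : closed_on a b P.
    move=> i j hi hj eij ia; apply: contrapT => ja; apply: nu; exists j.
    by move: eij; rewrite ia => ->; rewrite andbT; rewrite /P in ja; lia.
  have := conn P cl a b _ _ erefl; rewrite /P /b => h; lia.
have [||t /andP[atb Eat] tmax] := @ex_maxnP (fun u => (a < u <= b) && E a u) b.
- by exists u0.
- by move=> i; lia.
(* the graph on the interval without the edge from [a] to [t] *)
pose E' i j := [&& a <= i <= b, a <= j <= b, E i j,
  ~~ ((i == a) && (j == t)) & ~~ ((i == t) && (j == a))].
have E'sym i j : E' i j -> E' j i.
  by case/and5P => ? ? /Esym ? ? ?; apply/and5P; split=> //; lia.
pose X i := forall P : nat -> Prop, P a -> (forall i j, E' i j -> P i -> P j) -> P i.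
pose Y i := forall P : nat -> Prop, P t -> (forall i j, E' i j -> P i -> P j) -> P i.
have Xa : X a by [].
have Yt : Y t by [].
have XE i j : E' i j -> X i -> X j by move=> e xi P Pa cl; apply: (cl _ _ e (xi P Pa cl)).
have YE i j : E' i j -> Y i -> Y j by move=> e xi P Pa cl; apply: (cl _ _ e (xi P Pa cl)).
have Xrange i : X i -> a <= i <= b.
  by move/(_ (fun i => is_true (a <= i <= b))); apply; [lia|move=> u v /and5P[]].
have nXt : ~ X t.
  move=> Xt; have [p [ep lp]] : exists p, path E' a p /\ last a p = t.
    apply: (Xt (fun i => exists p, path E' a p /\ last a p = i)); first by exists [::].
    move=> i j eij [p [pp lp]]; exists (rcons p j).
    by rewrite rcons_path pp lp last_rcons.
  case/shortenP: ep lp => q eq uq _ lq.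
  have : size (a :: q) <= 2.
    apply: Eac; rewrite /ucycle uq andbT /= rcons_path lq Esym // andbT.
    by apply: sub_path eq => i j /and5P[].
  case: q eq uq lq => [|v [|]] //= eq _ lq; first by move: atb; rewrite lq ltnn.
  by move: eq; rewrite lq /E' !eqxx /= !andbF.
have dis i : X i -> Y i -> False.
  move=> xi yi; apply: nXt; move: xi.
  apply: (yi (fun i => X i -> X t)) => // u v /E'sym euv h /(XE _ _ euv).
  exact: h.
have XorY i : a <= i <= b -> X i \/ Y i.
  move=> hi; apply: (conn (fun i => X i \/ Y i) _ a i) => //; [|by rewrite /b; lia|by left].
  move=> u v hu hv euv xy; have [/eqP[_ ->]|n1] := boolP ((u, v) == (a, t)); first by right.
  have [/eqP[_ ->]|n2] := boolP ((u, v) == (t, a)); first by left.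
  have e' : E' u v by apply/and5P.
  by case: xy => [/(XE _ _ e')|/(YE _ _ e')]; [left|right].
(* leaving [X] to the right of [t] would need an edge over [t] *)
have Xt i : X i -> i < t.
  move=> xi; suff [] : X i /\ i < t by [].
  apply: (xi (fun v => X v /\ v < t)) => [|u v euv [xu ut]]; first by split=> //; lia.
  have xv := XE _ _ euv xu; split=> //; rewrite ltnNge; apply/negP => tv.
  have vt : v != t by apply: contra_notN nXt => /eqP <-.
  case/and5P: euv => hu hv euv _ _.
  have [ua|ua] := eqVneq u a.
    by have := tmax v; rewrite -ua euv andbT; lia.
  by apply: (Enc _ _ _ Eat euv); lia.
(* [X] is an initial segment of the interval *)
have Xdown i j : a <= i -> i < j -> X j -> X i.
  move=> ai ij xj; apply: contrapT => nxi.
  have yi : Y i by case: (XorY i) => //; have := Xrange _ xj; lia.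
  have [[]|[u [v [xu euv uv]]]] : X j /\ j < i \/ (exists u v, [/\ X u, E' u v & u < i < v]).
  + apply: (xj (fun j => X j /\ j < i \/ (exists u v, [/\ X u, E' u v & u < i < v]))) => [|u v euv [[xu ui]|]]; last by right.
      left; split=> //; rewrite ltn_neqAle ai andbT.
      by apply: contra_notN nxi => /eqP <-.
    have xv := XE _ _ euv xu.
    have vi : v != i by apply: contra_notN nxi => /eqP <-.
    case: (ltnP v i) => h; first by left.
    by right; exists u, v; split=> //; lia.
  + by lia.
  have xv := XE _ _ euv xu; have vt := Xt _ xv.
  have [_] : ~ X i /\ ~ (u < i < v); last by [].
  apply: (yi (fun i => ~ X i /\ ~ (u < i < v))) => [|c d ecd [xc hc]]; first by split=> //; lia.
  have xd : ~ X d by move=> /(XE _ _ (E'sym _ _ ecd)).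
  split=> // hd.
  have cu : c != u by apply/eqP => e; apply: xc; rewrite e.
  have cv : c != v by apply/eqP => e; apply: xc; rewrite e.
  case/and5P: ecd => _ _ ecd _ _; case/and5P: euv => _ _ euv' _ _.
  have [cltu|vltc] : c < u \/ v < c by lia.
    by apply: (Enc _ _ _ ecd euv'); lia.
  by apply: (Enc _ _ _ euv' (Esym ecd)); lia.
have [||s /asboolP Xs smax] := @ex_maxnP (fun i => `[< X i >]) b.
- by exists a; apply/asboolP.
- by move=> i /asboolP /Xrange; lia.
have Xle i : X i -> i <= s by move=> xi; apply: smax; apply/asboolP.
have leX i : a <= i <= s -> X i.
  move=> hi; have [->//|ne] := eqVneq i s; apply: Xdown Xs; lia.
have ls := Xt _ Xs; have as_ := Xrange _ Xs.
have nXY i : s < i <= b -> Y i /\ ~ X i.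
  move=> hi; have nx : ~ X i by move=> /Xle; lia.
  by split=> //; case: (XorY i) => //; lia.
(* no edge of [Y] passes over [t], since it would cross the edge from [a] *)
have Ycross i j : E' i j -> Y i -> ~ (i < t < j) /\ ~ (j < t < i).
  move=> e yi; have yj := YE _ _ e yi.
  have ni : ~~ (i <= s) by apply/negP => h; apply: (dis i) => //; apply: leX; case/and5P: e; lia.
  have nj : ~~ (j <= s) by apply/negP => h; apply: (dis j) => //; apply: leX; case/and5P: e; lia.
  case/and5P: e => _ _ e _ _; split=> h.
    by apply: (Enc _ _ _ Eat e); lia.
  by apply: (Enc _ _ _ Eat (Esym e)); lia.
have c1 : connected_on a s.
  apply: (@connected_root _ _ a); first by lia.
  move=> P cl Pa i hi; suff [] : X i /\ P i by [].
  apply: (leX i hi (fun i => X i /\ P i)) => // u v euv [xu pu]; have xv := XE _ _ euv xu.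
  split=> //; apply: cl pu; last by case/and5P: euv.
    by have := Xle _ xu; have := Xrange _ xu; lia.
  by have := Xle _ xv; have := Xrange _ xv; lia.
have Ygt i : Y i -> a <= i -> s < i.
  by move=> yi ai; rewrite ltnNge; apply/negP => h; apply: (dis i) => //; apply: leX; lia.
have c2 : connected_on s.+1 t.
  apply: (@connected_root _ _ t); first by lia.
  move=> P cl Pt i hi; have [|yi _] := nXY i; first by lia.
  suff [_] : Y i /\ (i <= t -> P i) by apply; lia.
  apply: (yi (fun i => Y i /\ (i <= t -> P i))) => // u v euv [yu pu]; have yv := YE _ _ euv yu.
  split=> // vt; have [_ h] := Ycross _ _ euv yu.
  have [->//|nvt] := eqVneq v t.
  have [ru rv] : a <= u /\ a <= v by case/and5P: euv; lia.
  have := Ygt _ yu ru; have := Ygt _ yv rv => ? ?.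
  by apply: (cl u v); [lia|lia|case/and5P: euv|apply: pu; lia].
have c3 : connected_on t b.
  apply: (@connected_root _ _ t); first by lia.
  move=> P cl Pt i hi; have [|yi _] := nXY i; first by lia.
  suff [_] : Y i /\ (t <= i -> P i) by apply; lia.
  apply: (yi (fun i => Y i /\ (t <= i -> P i))) => // u v euv [yu pu]; have yv := YE _ _ euv yu.
  split=> // vt; have [h _] := Ycross _ _ euv yu.
  have [->//|nvt] := eqVneq v t.
  have [ru rv] : u <= b /\ v <= b by case/and5P: euv; lia.
  by apply: (cl u v); [lia|lia|case/and5P: euv|apply: pu; lia].
have [||xa [sa ha]] := IH (s - a) _ a; first by lia.
  by rewrite subnKC //; lia.
have [||xb [sb hb]] := IH (t - s.+1) _ s.+1; first by lia.
  by rewrite subnKC //; lia.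
have [||xc [sc hc]] := IH (b - t) _ t; first by lia.
  by rewrite subnKC //; lia.
exists (N xa xb xc); split; first by rewrite /=; lia.
move=> i j ai ij jb; rewrite /= inE !mem_cat.
have -> : a + sz xa + 1 = s.+1 by lia.
have -> : s.+1 + sz xb = t by lia.
split; last first.
  case/or4P => [/eqP[-> ->]//|h|h|h]; have r := arcs_range h.
  - by apply/ha => //; lia.
  - by apply/hb => //; lia.
  - by apply/hc => //; lia.
move=> eij; have [//|n1] := boolP ((i, j) == (a, t)).
have e' : E' i j.
  by apply/and5P; split=> //; [lia|lia|apply/negP => /andP[/eqP ? /eqP ?]; lia].
case: (XorY i) => [|xi|yi]; first by lia.
  have xj := XE _ _ e' xi; have := Xle _ xj => js.
  by have -> : (i, j) \in arcs a xa by apply/ha => //; lia.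
have yj := YE _ _ e' yi; have [h _] := Ycross _ _ e' yi.
have is_ := Ygt _ yi ai.
have [jt|jt] := leqP j t.
  by have -> : (i, j) \in arcs s.+1 xb by [apply/hb => //; lia]; rewrite !orbT.
by have -> : (i, j) \in arcs t xc by [apply/hc => //; lia]; rewrite !orbT.
Qed.

End NoncrossingTrees.

Lemma ncst_tree n (T : {set edge n}) : is_ncst T ->
  exists x, sz x = n /\ T = tree_set n x.
Proof.
case/and4P => /forall_inP Tlt /forallP Tconn /forallP Tac /forall_inP Tnc.
pose E i j := [&& i <= n, j <= n & adj T (inord i) (inord j)].
have Tadj i j : E i j -> i < j -> (inord i, inord j) \in T.
  case/and3P => hi hj /orP[//|/Tlt /=]; rewrite !inordK //; lia.
have EP (i j : 'I_n.+1) : E i j = adj T i j.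
  by rewrite /E !inord_val !leq_ord.
have Esym i j : E i j -> E j i.
  by case/and3P => hi hj h; apply/and3P; split=> //; rewrite /adj orbC.
have Enc i j k l : i < k -> k < j -> j < l -> E i j -> E k l -> False.
  move=> ik kj jl hij hkl.
  have h1 := Tadj _ _ hij (ltn_trans ik kj); have h2 := Tadj _ _ hkl (ltn_trans kj jl).
  have /forall_inP/(_ _ h2) /= := Tnc _ h1.
  case/and3P: hij => ? ? _; case/and3P: hkl => ? ? _.
  by rewrite !inordK ?ik ?kj ?jl.
have Eac p : ucycle E p -> size p <= 2.
  case/andP => cp up.
  have pn v : v \in p -> v <= n by move=> /(next_cycle cp) /and3P[].
  pose q : seq 'I_n.+1 := map inord p.
  have uq : uniq q.
    by rewrite map_inj_in_uniq // => i j /pn hi /pn hj /(congr1 val); rewrite /= !inordK.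
  have cq : cycle (adj T) q.
    by rewrite cycle_map; apply: sub_cycle cp => i j /and3P[].
  have sq : size q < n.+2.
    by rewrite ltnS -(card_uniqP uq) (leq_trans (max_card _)) ?card_ord.
  rewrite -(size_map (@inord n) p).
  have /forallP/(_ (in_tuple q))/implyP /= := Tac (Ordinal sq).
  by apply; rewrite /ucycleb cq.
have conn : connected_on E 0 (0 + n).
  apply: (@connected_root E Esym _ _ 0) => // P cl P0 i; rewrite add0n => hi.
  (* a property closed under the edges is a union of connected components *)
  have cT : closed (adj T) [pred v : 'I_n.+1 | `[< P v >]].
    move=> u v; rewrite -EP => euv; rewrite !inE; apply/asboolP/asboolP.
      by apply: cl euv => //; rewrite add0n leq_ord.
    by apply: cl (Esym _ _ euv) => //; rewrite add0n leq_ord.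
  have /(closed_connect cT) : connect (adj T) ord0 (inord i) by exact/forallP/Tconn.
  rewrite !inE /= inordK ?ltnS // => h; apply/asboolP; rewrite -h.
  exact/asboolP.
have [x [sx hx]] := noncrossing_tree Esym Enc Eac conn.
exists x; split=> //; apply/setP => -[u v]; rewrite inE /=.
have := ltn_ord u; have := ltn_ord v => hv hu.
have [uv|vu] := ltnP u v; last first.
  by apply/idP/idP => [/Tlt /=|/arcs_range]; lia.
apply/idP/idP => [h|/hx h].
  by apply/hx; rewrite ?EP ?/adj ?h //; lia.
by have := Tadj u v; rewrite !inord_val; apply=> //; apply: h; lia.
Qed.

Lemma mem_arcs_a o a b c i j :
  ((i, j) \in arcs o a) = ((i, j) \in arcs o (N a b c)) && (j <= o + sz a).
Proof.
rewrite /= inE !mem_cat; apply/idP/andP => [h|[/or4P[/eqP[-> ->]|h|h|h]]].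
- by have r := arcs_range h; split; [rewrite h !(orbT, orTb)|lia].
- by lia.
- by [].
- by have := arcs_range h; lia.
- by have := arcs_range h; lia.
Qed.

Lemma mem_arcs_b o a b c i j :
  ((i, j) \in arcs (o + sz a + 1) b) = ((i, j) \in arcs o (N a b c)) &&
    (o + sz a < i) && (j <= o + sz a + 1 + sz b).
Proof.
rewrite /= inE !mem_cat -andbA; apply/idP/and3P => [h|[/or4P[/eqP[-> ->]|h|h|h]]].
- by have r := arcs_range h; split; [rewrite h !(orbT, orTb)|lia|lia].
- by lia.
- by have := arcs_range h; lia.
- by [].
- by have := arcs_range h; lia.
Qed.

Lemma mem_arcs_c o a b c i j :
  ((i, j) \in arcs (o + sz a + 1 + sz b) c) = ((i, j) \in arcs o (N a b c)) &&
    (o + sz a + 1 + sz b <= i).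
Proof.
rewrite /= inE !mem_cat; apply/idP/andP => [h|[/or4P[/eqP[-> ->]|h|h|h]]].
- by have r := arcs_range h; split; [rewrite h !(orbT, orTb)|lia].
- by lia.
- by have := arcs_range h; lia.
- by have := arcs_range h; lia.
- by [].
Qed.

(** The root edge is the longest one at the first vertex.  If the first subtree were
    larger in one tree than in the other, its own edges would connect, in the other
    tree, the two sides of the root edge. *)
Lemma arcs_inj o x y : arcs o x =i arcs o y -> x = y.
Proof.
elim: x o y => [|a IHa b IHb c IHc] o [|a' b' c'] // e.
- by have := e (o, o + sz a' + 1 + sz b'); rewrite !inE eqxx.
- by have := e (o, o + sz a + 1 + sz b); rewrite !inE eqxx.
have le_t u v w u' v' w' : arcs o (N u v w) =i arcs o (N u' v' w') ->
    sz u + sz v <= sz u' + sz v'.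
  move=> /(_ (o, o + sz u + 1 + sz v)); rewrite /= inE eqxx /= inE mem_cat => /esym.
  case/orP => [/eqP[]|]; first by lia.
  by rewrite mem_cat => /or3P[] /arcs_range; lia.
have le_s u v w u' v' w' : arcs o (N u v w) =i arcs o (N u' v' w') ->
    sz u + sz v = sz u' + sz v' -> sz u' <= sz u.
  move=> euv est; rewrite leqNgt; apply/negP => lt_u.
  have h : forall i j, (i, j) \in arcs o u' -> (i <= o + sz u <-> j <= o + sz u).
    move=> i j hij; have r := arcs_range hij.
    have := euv (i, j); rewrite /= !inE !mem_cat hij orbT.
    by case/or4P => [/eqP[]|h|h|h]; try have := arcs_range h; lia.
  by have := arcs_connected h (k := o + sz u'); lia.
have et : sz a + sz b = sz a' + sz b'.
  by apply/eqP; rewrite eqn_leq (le_t _ _ _ _ _ _ e) (le_t _ _ _ _ _ _ (fsym e)).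
have es : sz a = sz a'.
  apply/eqP; rewrite eqn_leq (le_s _ _ _ _ _ _ e) // (le_s _ _ _ _ _ _ (fsym e)) //.
have eb : sz b = sz b' by lia.
congr N.
- by apply: (IHa o) => -[i j]; rewrite (mem_arcs_a o a b c) e es -mem_arcs_a.
- apply: (IHb (o + sz a + 1)) => -[i j].
  by rewrite (mem_arcs_b o a b c) e es eb -mem_arcs_b.
- apply: (IHc (o + sz a + 1 + sz b)) => -[i j].
  by rewrite (mem_arcs_c o a b c) e es eb -mem_arcs_c.
Qed.

Lemma tree_set_inj n x y : sz x = n -> sz y = n ->
  tree_set n x = tree_set n y -> x = y.
Proof.
move=> ex ey exy; apply: (@arcs_inj 0) => -[i j].
wlog suff h : x y ex ey exy / (i, j) \in arcs 0 x -> (i, j) \in arcs 0 y.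
  by apply/idP/idP; apply: h.
move=> h; have r := arcs_range h; rewrite ex in r.
have /setP/(_ (inord i, inord j)) := exy; rewrite !inE /= !inordK ?h //; lia.
Qed.

(** * The two state spaces *)

Local Open Scope ring_scope.

Lemma steps_inj n : injective (@steps n).
Proof. by move=> X Y e; do 2 apply: val_inj. Qed.

Lemma edges_inj n : injective (@edges n).
Proof. exact: val_inj. Qed.

Lemma steps_of_tree n x : sz x = n -> exists X : dyck2 n, steps X = word x.
Proof.
move=> ex; have ew : size (word x) == (3 * n)%N by rewrite size_word ex.
by exists (Sub (Tuple ew) (word_dyck2 x)); rewrite /steps SubK.
Qed.

Lemma ncst_of_tree n x : sz x = n -> exists T : ncst n, edges T = tree_set n x.
Proof. by move=> ex; exists (Sub (tree_set n x) (tree_set_ncst ex)); rewrite /edges SubK. Qed.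

Lemma tree_of_ncst n (T : ncst n) : exists x, sz x = n /\ edges T = tree_set n x.
Proof. exact: ncst_tree (valP T). Qed.

Lemma card_ncst_le n : (#|{: ncst n}| <= #|{: dyck2 n}|)%N.
Proof.
have /choice[g hg] : forall T : ncst n, exists X : dyck2 n,
    exists x, edges T = tree_set n x /\ steps X = word x.
  move=> T; have [x [ex eT]] := tree_of_ncst T.
  by have [X eX] := steps_of_tree ex; exists X, x.
apply: (leq_card g) => T1 T2 e; apply: edges_inj.
have [x [-> e1]] := hg T1; have [y [-> e2]] := hg T2.
by congr tree_set; apply: word_inj; rewrite -e1 -e2 e.
Qed.

Lemma card_ncst_gt0 n : (0 < #|{: ncst n}|)%N.
Proof.
have ex : sz (iter n (N L L) L) = n by elim: n => //= n ->.
by have [T _] := ncst_of_tree ex; apply/card_gt0P; exists T.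
Qed.

Lemma swap_adj_cat u a b v : swap_adj (size u) (u ++ a :: b :: v) = u ++ b :: a :: v.
Proof.
rewrite /swap_adj !nth_cat ltnn subnn ltnNge leqnSn /= subSnn /=.
by elim: u => //= c u ->.
Qed.

Lemma split_adj (X : seq bool) i : (i.+1 < size X)%N ->
  exists u v, size u = i /\ X = u ++ nth false X i :: nth false X i.+1 :: v.
Proof.
move=> hi; exists (take i X), (drop i.+2 X); split; first by rewrite size_takel // ltnW // ltnW.
by rewrite -!drop_nth ?cat_take_drop // ltnW.
Qed.

Definition am_pos (z : loc) : nat :=
  if z is (K, N a _ _) then (size (pre K) + (size (word a)).+1)%N else 0%N.

(** If no parent holds the peak in its first or second child, then the peak starts
    at height one, and the exchanged word goes below zero. *)
Lemma am_locate n (X Y : seq bool) u v : is_dyck2 X -> is_dyck2 Y ->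
  size X = (3 * n)%N ->
  X = u ++ [:: true, false & v] -> Y = u ++ [:: false, true & v] ->
  exists2 z, z \in locs n & [/\ word (plug z.1 z.2) = X,
     word (am_target z) = Y & am_pos z = size u].
Proof.
move=> /dyck2_word[x ex] dY sX eX eY.
have [K [a [c [exK eu ev]]]] := locate (etrans ex eX).
have enx : sz x = n by move: sX; rewrite -ex size_word; lia.
exists (K, N a L c); first by rewrite mem_locs -exK enx eqxx.
split; rewrite /= -?exK ?eu ?size_cat //; last first.
have := strip_cat K; have := strip_frame K; case: (strip K) => q [|[b' c'|a' c'|//] K0] /= _ eK.
- move: eu; rewrite -eK pre_spine /= => eu.
  have /is_dyck2P[/(_ (size u).+1) + _] := dY.
  rewrite eY -cat_rcons take_size_cat ?size_rcons // -cats1 eu !height_cat !height_cons.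
  by rewrite height_nil !height_word.
- rewrite word_plug eY eu ev -eK pre_spine post_spine /=.
  by rewrite -?catA /= -?catA /= -?catA /= -?catA.
- rewrite word_plug eY eu ev -eK pre_spine post_spine /= word_tcat /=.
  by rewrite -?catA /= -?catA /= -?catA /= -?catA.
Qed.

Lemma nodes_plug0 K x : x != L -> (K, x) \in nodes [::] (plug K x).
Proof. by move=> xL; have := nodes_plug K [::] xL; rewrite cats0. Qed.

Lemma uniq_map_inj (A B : eqType) (g : A -> B) (s : seq A) :
  uniq (map g s) -> {in s &, injective g}.
Proof.
move=> u a b ha hb e; rewrite -(nth_index a ha) -(nth_index a hb); congr nth.
apply/eqP; rewrite -(nth_uniq (g a) _ _ u) ?size_map ?index_mem //.
by rewrite !(nth_map a) ?index_mem // !nth_index // e.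
Qed.

(** * Comparison of the Dirichlet forms *)

Section Compare.
Variables (R : realType) (n : nat).
Hypothesis n_gt0 : (0 < n)%N.
Variables (f : dyck2 n -> R) (fT : ncst n -> R).
Hypothesis ffT : forall (X : dyck2 n) (T : ncst n),
  tree_path (edges T) (steps X) -> fT T = f X.

(** The common function on ternary trees.  The sum has exactly one term when [x] has
    [n] nodes; this form needs no default path. *)
Definition on_trees (x : tern) : R := \sum_(X : dyck2 n | steps X == word x) f X.
Local Notation F := on_trees.

Lemma on_trees_dyck X x : steps X = word x -> F x = f X.
Proof.
move=> eX; rewrite /on_trees (big_pred1 X) // => Y.
by rewrite /= -eX; apply/eqP/eqP => [/steps_inj|->].
Qed.

Lemma on_trees_ncst T x : sz x = n -> edges T = tree_set n x -> F x = fT T.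
Proof.
move=> ex eT; have [X eX] := steps_of_tree ex.
rewrite (on_trees_dyck eX); symmetry; apply: ffT; rewrite eT eX.
exact: tree_set_path.
Qed.

Definition ord_arc (p : nat * nat) : edge n := (inord p.1, inord p.2).

(** The energy of all the flips of [S] that remove [e].  The sum over [T] only serves
    to turn the set that results from a flip into a point of the state space. *)
Definition flip_sum (S : ncst n) (e : edge n) : R :=
  \sum_(T : ncst n) \sum_(e' in addable (edges S :\ e))
    (edges T == e' |: (edges S :\ e))%:R * (fT S - fT T) ^+ 2.

Definition loc_sum (z : loc) : R :=
  \sum_(S : ncst n | edges S == tree_set n (plug z.1 z.2))
     flip_sum S (ord_arc (root_arc z.1 z.2)).

Lemma flip_sum_ge0 S e : 0 <= flip_sum S e.
Proof.
apply: sumr_ge0 => T _; apply: sumr_ge0 => e' _.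
by rewrite mulr_ge0 ?ler0n ?sqr_ge0.
Qed.

Lemma loc_sum_ge0 z : 0 <= loc_sum z.
Proof. by apply: sumr_ge0 => S _; apply: flip_sum_ge0. Qed.

Lemma mem_root_arc K x : x != L -> root_arc K x \in arcs 0 (plug K x).
Proof.
move=> xL; rewrite -(root_arcs [::]).
by apply/mapP; exists (K, x) => //; apply: nodes_plug0.
Qed.

(** The case where the two exchanged edges coincide is included; both sides are
    then the same tree. *)
Lemma tree_set_flip x y e e' : sz x = n -> sz y = n ->
  e \in arcs 0 x -> perm_eq (e' :: arcs 0 x) (e :: arcs 0 y) ->
  tree_set n y = ord_arc e' |: (tree_set n x :\ ord_arc e).
Proof.
move=> ex ey ein pe.
have rng p : p \in e :: arcs 0 y -> (p.1 <= n)%N /\ (p.2 <= n)%N.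
  rewrite inE => /orP[/eqP->|]; first by case: e {pe} ein => i j /arcs_range /=; lia.
  by case: p => i j /arcs_range /=; lia.
have [e1 e2] : (e'.1 <= n)%N /\ (e'.2 <= n)%N.
  by apply: rng; rewrite -(perm_mem pe) inE eqxx.
have [g1 g2] : (e.1 <= n)%N /\ (e.2 <= n)%N by apply: rng; rewrite inE eqxx.
apply/setP => -[u v]; rewrite !inE /=.
have eqo p : (p.1 <= n)%N -> (p.2 <= n)%N ->
    ((u, v) == ord_arc p) = ((u : nat, v : nat) == p).
  case: p => i j /= hi hj; rewrite /ord_arc /= !xpair_eqE -!val_eqE /=.
  by rewrite !inordK.
rewrite !eqo //; set p := (u : nat, v : nat).
have /= := permP pe (pred1 p).
rewrite !count_uniq_mem ?uniq_arcs // (eq_sym e') (eq_sym e).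
have [->|_] := eqVneq p e; first by rewrite ein; case: (e == e'); case: (e \in _).
by case: (p == e'); case: (p \in arcs 0 x); case: (p \in arcs 0 y).
Qed.

Lemma loc_sum_flip K x y e' : x != L -> sz (plug K x) = n -> sz y = n ->
  perm_eq (e' :: arcs 0 (plug K x)) (root_arc K x :: arcs 0 y) ->
  (F (plug K x) - F y) ^+ 2 <= loc_sum (K, x).
Proof.
move=> xL ex ey pe; have [S eS] := ncst_of_tree ex; have [T eT] := ncst_of_tree ey.
rewrite (on_trees_ncst ex eS) (on_trees_ncst ey eT) /loc_sum /=.
rewrite (big_pred1 S); last first.
  by move=> S'; rewrite /= -eS; apply/eqP/eqP => [/edges_inj|->].
have eTS := tree_set_flip ex ey (mem_root_arc K xL) pe.
rewrite -eS -eT in eTS; set e0 := ord_arc _ in eTS *.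
rewrite /flip_sum (bigD1 T) //= (bigD1 (ord_arc e')) /=; last first.
  by rewrite inE -eTS; apply: (valP T).
rewrite eTS eqxx mul1r -addrA lerDl addr_ge0 //.
  by apply: sumr_ge0 => e _; rewrite mulr_ge0 ?ler0n ?sqr_ge0.
apply: sumr_ge0 => T' _; apply: sumr_ge0 => e _.
by rewrite mulr_ge0 ?ler0n ?sqr_ge0.
Qed.

Lemma sum_loc_sum :
  \sum_(z <- locs n) loc_sum z <= \sum_(S : ncst n) \sum_(e in edges S) flip_sum S e.
Proof.
rewrite /loc_sum (exchange_big_dep xpredT) //=; apply: ler_sum => S _.
have [x [ex eS]] := tree_of_ncst S.
rewrite -big_filter -[leRHS]big_enum /=.
apply: (sum_map_le (phi := fun z => ord_arc (root_arc z.1 z.2)) (G := flip_sum S)).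
- by rewrite filter_uniq ?uniq_locs.
- exact: enum_uniq.
- exact: flip_sum_ge0.
- move=> [K y]; rewrite mem_filter mem_locs => /and3P[/eqP eK yL /eqP ey].
  rewrite mem_enum eK inE /ord_arc /=; have := mem_root_arc K yL.
  case: (root_arc K y) => i j h; have := arcs_range h => r /=.
  by rewrite !inordK //; lia.
move=> [K1 y1] [K2 y2]; rewrite !mem_filter !mem_locs => /and3P[/eqP e1 y1L /eqP s1].
move=> /and3P[/eqP e2 y2L /eqP s2] /= eo.
have ep : plug K1 y1 = plug K2 y2 by apply: (tree_set_inj (n := n)) => //; rewrite -e1 -e2.
have m1 := nodes_plug0 K1 y1L; have m2 := nodes_plug0 K2 y2L; rewrite -ep in m2.
apply: (uniq_map_inj (g := fun z => root_arc z.1 z.2) _ m1 m2).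
  by rewrite root_arcs uniq_arcs.
have := mem_root_arc K1 y1L; have := mem_root_arc K2 y2L; rewrite /=.
case: (root_arc K1 y1) (root_arc K2 y2) eo => i1 j1 [i2 j2] /=.
case=> /(congr1 val) /= ei /(congr1 val) /= ej /arcs_range r2 /arcs_range r1.
move: ei ej; rewrite !inordK; try lia.
by move=> -> ->.
Qed.

(** At most (n + 1)^2 edges can be added to a forest, so each one is chosen with
    probability at least (n + 1)^-2. *)
Lemma flip_form_ge :
  (2 * #|{: ncst n}|%:R * n%:R * (n.+1 * n.+1)%:R)^-1 * \sum_(z <- locs n) loc_sum z
  <= dirichlet (@uniform R (ncst n)) (@P_FM R n) fT fT.
Proof.
set N := #|_|%:R; set M := (_ * _)%:R.
have N0 : 0 < N :> R by rewrite ltr0n card_ncst_gt0.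
have M0 : 0 < M :> R by rewrite ltr0n.
have n0 : 0 < n%:R :> R by rewrite ltr0n.
apply: le_trans (_ : (2 * N * n%:R * M)^-1 *
   (\sum_(S : ncst n) \sum_(e in edges S) flip_sum S e) <= _).
  by rewrite ler_wpM2l ?sum_loc_sum // invr_ge0 !mulr_ge0 ?ltW.
rewrite /dirichlet !invfM -!mulrA ler_wpM2l ?invr_ge0 ?ler0n //.
rewrite !mulrA mulr_sumr; apply: ler_sum => S _.
rewrite /flip_sum exchange_big /= mulr_sumr; apply: ler_sum => T _.
rewrite -/N /uniform /P_FM -!mulrA -/N.
set B := (X in _ <= (_ - _) * (_ * (_ * X))).
have key : n%:R^-1 * (M^-1 * \sum_(e in edges S) \sum_(e' in addable (edges S :\ e))
    (edges T == e' |: edges S :\ e)%:R) <= B.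
  rewrite mulrA mulr_sumr; apply: ler_sum => e _.
  rewrite -mulrA ler_wpM2l ?invr_ge0 ?ler0n // mulr_sumr.
  apply: ler_sum => e' he'; rewrite ler_wpM2r ?ler0n //.
  have a0 : (0 < #|addable (edges S :\ e)|)%N by apply/card_gt0P; exists e'.
  rewrite lef_pV2 ?posrE ?ltr0n // ler_nat.
  by apply: leq_trans (max_card _) _; rewrite card_prod card_ord.
have -> : \sum_(e in edges S) \sum_(e' in addable (edges S :\ e))
     (edges T == e' |: edges S :\ e)%:R * (fT S - fT T) ^+ 2 =
   (\sum_(e in edges S) \sum_(e' in addable (edges S :\ e))
     (edges T == e' |: edges S :\ e)%:R) * (fT S - fT T) ^+ 2.
  by rewrite mulr_suml; apply: eq_bigr => e _; rewrite mulr_suml.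
set A := \sum_(e in edges S) _ in key *.
have -> : (fT S - fT T) * ((fT S - fT T) * (N^-1 * B)) =
   (N^-1 * (fT S - fT T) ^+ 2) * B by ring.
have -> : N^-1 * (n%:R^-1 * (M^-1 * (A * (fT S - fT T) ^+ 2))) =
   (N^-1 * (fT S - fT T) ^+ 2) * (n%:R^-1 * (M^-1 * A)) by ring.
by rewrite ler_wpM2l // mulr_ge0 ?sqr_ge0 // invr_ge0 ltW.
Qed.

Definition peak_swap (i : nat) (X Y : seq bool) : bool :=
  [&& nth false X i, ~~ nth false X i.+1 & Y == swap_adj i X].

Lemma swap_adjP (X Y : seq bool) i : (i.+1 < size X)%N ->
  Y = swap_adj i X -> [\/ Y = X, peak_swap i X Y | peak_swap i Y X].
Proof.
case/split_adj => u [v []]; move: (nth _ X _) (nth _ X _) => a b <- -> ->.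
rewrite /peak_swap !swap_adj_cat !nth_cat ltnn subnn ltnNge leqnSn /= subSnn /=.
by case: a b => -[]; [apply: Or31|apply: Or33|apply: Or32|apply: Or31]; rewrite ?eqxx.
Qed.

(** An exchange and its inverse contribute equally, and exactly one of the two
    exchanges a peak. *)
Lemma am_form_le :
  dirichlet (@uniform R (dyck2 n)) (@P_AM R n) f f <=
  (2 * #|{: dyck2 n}|%:R * (3 * n - 1)%:R)^-1 *
  \sum_(X : dyck2 n) \sum_(Y : dyck2 n) \sum_(i < 3 * n - 1)
     (peak_swap i (steps X) (steps Y))%:R * (f X - f Y) ^+ 2.
Proof.
set N := #|_|%:R; set M := (3 * n - 1)%:R.
pose D (X Y : dyck2 n) (i : 'I_(3 * n - 1)) : R := (peak_swap i (steps X) (steps Y))%:R * (f X - f Y) ^+ 2.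
have N0 : 0 <= N^-1 :> R by rewrite invr_ge0 ler0n.
have M0 : 0 <= M^-1 :> R by rewrite invr_ge0 ler0n.
have sym : \sum_X \sum_Y \sum_i D X Y i + \sum_X \sum_Y \sum_i D Y X i =
   2 * \sum_X \sum_Y \sum_i D X Y i.
  rewrite [X in _ + X = _]exchange_big /=; ring.
have D0 X Y i : 0 <= D X Y i by rewrite mulr_ge0 ?ler0n ?sqr_ge0.
have bnd X Y : (f X - f Y) * (f X - f Y) * uniform R X * P_AM R X Y <=
    N^-1 * M^-1 * 2^-1 * (\sum_i D X Y i + \sum_i D Y X i).
  have [->|neXY] := eqVneq X Y.
    rewrite subrr !mul0r !mulr_ge0 ?addr_ge0 ?invr_ge0 ?ler0n //; exact: sumr_ge0.
  have -> : \sum_i D X Y i + \sum_i D Y X i = (\sum_(i < 3 * n - 1)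
     ((peak_swap i (steps X) (steps Y))%:R + (peak_swap i (steps Y) (steps X))%:R))
      * (f X - f Y) ^+ 2.
    rewrite -big_split mulr_suml; apply: eq_bigr => i _ /=.
    by rewrite /D mulrDl; congr (_ + _ * _); ring.
  set Q := \sum_(i < _) _; have Ple : P_AM R X Y <= M^-1 * 2^-1 * Q.
    rewrite /P_AM /Q mulr_sumr; apply: ler_sum => i _.
    rewrite -mulrA ler_wpM2l // (eq_sym Y X) (negPf neXY) mulr0 addr0.
    case: ifP => _; last by rewrite mulr_ge0 ?addr_ge0 ?ler0n ?invr_ge0.
    rewrite ler_wpM2l ?invr_ge0 ?ler0n //; case: eqP => [e|_]; last by rewrite addr_ge0 ?ler0n.
    have hi : (i.+1 < size (steps X))%N.
      by rewrite size_tuple; have := ltn_ord i; lia.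
    case: (swap_adjP hi e) => [/steps_inj eXY|->|->].
    - by rewrite eXY eqxx in neXY.
    - by rewrite lerDl ler0n.
    - by rewrite lerDr ler0n.
  have -> : N^-1 * M^-1 * 2^-1 * (Q * (f X - f Y) ^+ 2) =
    (f X - f Y) ^+ 2 * N^-1 * (M^-1 * 2^-1 * Q) by ring.
  by rewrite /uniform -/N -expr2 ler_wpM2l // mulr_ge0 ?sqr_ge0.
apply: le_trans (_ : 2^-1 * (\sum_X \sum_Y
    (N^-1 * M^-1 * 2^-1 * (\sum_i D X Y i + \sum_i D Y X i))) <= _).
  rewrite ler_wpM2l ?invr_ge0 ?ler0n //.
  by apply: ler_sum => X _; apply: ler_sum => Y _; apply: bnd.
have -> : \sum_X \sum_Y (N^-1 * M^-1 * 2^-1 * (\sum_i D X Y i + \sum_i D Y X i)) =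
    N^-1 * M^-1 * 2^-1 * (2 * \sum_X \sum_Y \sum_i D X Y i).
  rewrite -sym -big_split /= mulr_sumr.
  by apply: eq_bigr => X _; rewrite -big_split /= mulr_sumr.
rewrite !invfM; set S := \sum_X _; rewrite le_eqVlt; apply/orP; left; apply/eqP.
by rewrite -!mulrA; congr (_ * (_ * (_ * _))); rewrite mulKf ?pnatr_eq0.
Qed.

Lemma sum_peak_swap_le :
  \sum_(X : dyck2 n) \sum_(Y : dyck2 n) \sum_(i < 3 * n - 1)
     (peak_swap i (steps X) (steps Y))%:R * (f X - f Y) ^+ 2 <=
  \sum_(z <- locs n) (F (plug z.1 z.2) - F (am_target z)) ^+ 2.
Proof.
pose T : finType := (dyck2 n * (dyck2 n * 'I_(3 * n - 1)))%type.
pose sub (p : T) := [seq z <- locs n | [&& peak_swap p.2.2 (steps p.1) (steps p.2.1),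
   word (plug z.1 z.2) == steps p.1, word (am_target z) == steps p.2.1 & am_pos z == p.2.2]].
pose H z := (F (plug z.1 z.2) - F (am_target z)) ^+ 2.
have -> : \sum_(X : dyck2 n) \sum_(Y : dyck2 n) \sum_(i < 3 * n - 1)
     (peak_swap i (steps X) (steps Y))%:R * (f X - f Y) ^+ 2 =
   \sum_(p : T) (peak_swap p.2.2 (steps p.1) (steps p.2.1))%:R * (f p.1 - f p.2.1) ^+ 2.
  rewrite -(pair_bigA _ (fun (X : dyck2 n) (q : dyck2 n * 'I_(3 * n - 1)) =>
    (peak_swap q.2 (steps X) (steps q.1))%:R * (f X - f q.1) ^+ 2)) /=.
  apply: eq_bigr => X _.
  by rewrite (pair_bigA _ (fun (Y : dyck2 n) (i : 'I_(3 * n - 1)) =>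
    (peak_swap i (steps X) (steps Y))%:R * (f X - f Y) ^+ 2)).
apply: (@le_trans _ _ (\sum_(p : T) \sum_(z <- sub p) H z)).
  apply: ler_sum => -[X [Y i]] _ /=.
  have [pk|_] := boolP (peak_swap _ _ _); last by rewrite mul0r sumr_ge0 // => z _; apply: sqr_ge0.
  have hi : (i.+1 < size (steps X))%N.
    by rewrite size_tuple; have := ltn_ord i; lia.
  have [u [v [su eX]]] := split_adj hi.
  have /and3P[h1 /negPf h2 /eqP eY] := pk; rewrite h1 h2 in eX.
  have eY' : steps Y = u ++ [:: false, true & v] by rewrite eY eX -su swap_adj_cat.
  have [z zl [e1 e2 e3]] := am_locate (valP X) (valP Y) (size_tuple _) eX eY'.
  rewrite mul1r (_ : _ ^+ 2 = H z); last first.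
    by rewrite /H (on_trees_dyck (esym e1)) (on_trees_dyck (esym e2)).
  have zin : z \in sub (X, (Y, i)).
    by rewrite mem_filter zl pk e1 e2 e3 su !eqxx.
  by rewrite (big_rem z zin) /= lerDl; apply: sumr_ge0 => ? _; apply: sqr_ge0.
rewrite -[leRHS]mul1r.
apply: (sum_sub_le (c := fun=> 0%N) (m := 1%N)) => //.
- exact: index_enum_uniq.
- exact: uniq_locs.
- by move=> z; apply: sqr_ge0.
- by move=> p _; rewrite filter_uniq ?uniq_locs.
- by move=> p z _; rewrite mem_filter => /andP[_].
move=> [X [Y i]] [X' [Y' i']] z _ _; rewrite !mem_filter /=.
case/andP => /and4P[_ /eqP e1 /eqP e2 /eqP e3] _.
case/andP => /and4P[_ /eqP e1' /eqP e2' /eqP e3'] _ _.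
congr (_, (_, _)); last by apply: val_inj; rewrite /= -e3.
  by apply: steps_inj; rewrite -e1.
by apply: steps_inj; rewrite -e2.
Qed.

Lemma am_form_le_loc_sum :
  dirichlet (@uniform R (dyck2 n)) (@P_AM R n) f f <=
  #|{: dyck2 n}|%:R^-1 * (104 * n)%:R * \sum_(z <- locs n) loc_sum z.
Proof.
apply: le_trans am_form_le _.
set P := \sum_(z <- locs n) loc_sum z; set N := #|_|%:R.
have P0 : 0 <= P by apply: sumr_ge0 => z _; apply: loc_sum_ge0.
have h1 : \sum_(z <- locs n) (F (plug z.1 z.2) - F (am_target z)) ^+ 2 <=
    (8 * n)%:R * ((52 * n)%:R * P).
  apply: (@le_trans _ _ (\sum_(z <- locs n) (8 * n)%:R * \sum_(y <- am_route z) loc_sum y)).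
    rewrite big_seq [leRHS]big_seq; apply: ler_sum => -[K x].
    rewrite mem_locs => /andP[xL /eqP ez].
    have le := linked_am loc_sum_ge0 loc_sum_flip (z := (K, x)) ez.
    apply: le_trans le _; apply: ler_wpM2r.
      by apply: sumr_ge0 => ? _; apply: loc_sum_ge0.
    by rewrite ler_nat; apply: leq_trans (size_am (z := (K, x)) ez) _; lia.
  rewrite -mulr_sumr ler_wpM2l ?ler0n //.
  exact: (sum_am loc_sum_ge0 (esym (prednK n_gt0))).
have h2 := le_trans sum_peak_swap_le h1.
apply: (@le_trans _ _ ((2 * N * (3 * n - 1)%:R)^-1 * ((8 * n)%:R * ((52 * n)%:R * P)))).
  by rewrite ler_wpM2l // invr_ge0 !mulr_ge0 ?ler0n.
have n0 : 0 < n%:R :> R by rewrite ltr0n.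
have hM : (2 * n)%:R <= (3 * n - 1)%:R :> R by rewrite ler_nat; lia.
have hM' : (3 * n - 1)%:R^-1 <= (2 * n)%:R^-1 :> R.
  by rewrite lef_pV2 ?posrE ?ltr0n //; lia.
have N0 : 0 <= N^-1 by rewrite invr_ge0 ler0n.
have e : (2 * n)%:R^-1 * ((8 * n)%:R * (52 * n)%:R) = (208 * n)%:R :> R.
  by rewrite !natrM; field; rewrite gt_eqF.
have k : (3 * n - 1)%:R^-1 * ((8 * n)%:R * (52 * n)%:R) <= (208 * n)%:R :> R.
  by rewrite -e ler_wpM2r // mulr_ge0 ?ler0n.
have -> : N^-1 * (104 * n)%:R * P = (2^-1 * N^-1 * P) * (208 * n)%:R.
  by rewrite !natrM; field; rewrite pnatr_eq0 -lt0n; apply: leq_trans (card_ncst_gt0 n) (card_ncst_le n).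
have -> : (2 * N * (3 * n - 1)%:R)^-1 * ((8 * n)%:R * ((52 * n)%:R * P)) =
   (2^-1 * N^-1 * P) * ((3 * n - 1)%:R^-1 * ((8 * n)%:R * (52 * n)%:R)).
  by rewrite !invfM; ring.
by rewrite ler_wpM2l // !mulr_ge0 ?invr_ge0 ?ler0n.
Qed.

Lemma comparison :
  832%:R^-1 * n%:R ^- 4 * dirichlet (@uniform R (dyck2 n)) (@P_AM R n) f f <=
  dirichlet (@uniform R (ncst n)) (@P_FM R n) fT fT.
Proof.
apply: le_trans flip_form_ge; set P := \sum_(z <- locs n) loc_sum z.
have P0 : 0 <= P by apply: sumr_ge0 => z _; apply: loc_sum_ge0.
have n0 : 0 < n%:R :> R by rewrite ltr0n.
have c0 : 0 <= 832%:R^-1 * n%:R ^- 4 :> R.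
  by rewrite mulr_ge0 ?invr_ge0 ?ler0n ?exprn_ge0.
apply: le_trans (ler_wpM2l c0 am_form_le_loc_sum) _.
rewrite -/P mulrA ler_wpM2r //.
set Nd := #|{: dyck2 n}|%:R; set Nt := #|{: ncst n}|%:R.
have Nt0 : 0 < Nt :> R by rewrite ltr0n card_ncst_gt0.
have NN : Nt <= Nd :> R by rewrite ler_nat card_ncst_le.
have NN' : Nd^-1 <= Nt^-1 :> R by rewrite lef_pV2 ?posrE // (lt_le_trans Nt0).
have hn : n.+1%:R <= 2 * n%:R :> R by rewrite -natrM ler_nat; lia.
have -> : 832%:R^-1 * n%:R ^- 4 * (Nd^-1 * (104 * n)%:R) = Nd^-1 * (8 * n%:R ^+ 3)^-1 :> R.
  by rewrite natrM; field; apply/andP; split; rewrite gt_eqF // (lt_le_trans Nt0).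
have -> : (2 * Nt * n%:R * (n.+1 * n.+1)%:R)^-1 = Nt^-1 * (2 * n%:R * (n.+1 * n.+1)%:R)^-1 :> R.
  by rewrite !invfM; ring.
apply: ler_pM => //; rewrite ?invr_ge0 ?mulr_ge0 ?exprn_ge0 ?ler0n //.
rewrite lef_pV2 ?posrE ?mulr_gt0 ?exprn_gt0 ?ltr0n // natrM.
have : n.+1%:R * n.+1%:R <= (2 * n%:R) * (2 * n%:R) :> R.
  by apply: ler_pM; rewrite ?ler0n.
move=> h; rewrite -mulrA.
have -> : 8 * n%:R ^+ 3 = 2 * (n%:R * (2 * n%:R * (2 * n%:R))) :> R by ring.
by rewrite ler_wpM2l ?ler0n // ler_wpM2l ?ler0n.
Qed.

End Compare.

Theorem lemma17 (R : realType) :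
  exists c : R, 0 < c /\
    forall (n : nat), (0 < n)%N ->
    forall (f : dyck2 n -> R) (fT : ncst n -> R),
      (forall (X : dyck2 n) (T : ncst n),
          tree_path (edges T) (steps X) -> fT T = f X) ->
      c * n%:R ^- 4 * dirichlet (@uniform R (dyck2 n)) (@P_AM R n) f f
        <= dirichlet (@uniform R (ncst n)) (@P_FM R n) fT fT.
Proof.
exists 832%:R^-1; split; first by rewrite invr_gt0 ltr0n.
by move=> n n0 f fT; apply: comparison.
Qed.
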